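(* Let $K$ be a field with $6K=K$ (i.e. $\mathrm{char}(K)\notin\{2,3\}$). Let $B\in\mathrm{Mat}_6(K[y_1,y_2,y_3]_1)$ be a skew-symmetric matrix of linear forms such that $\mathrm{Pf}(B)=0$ defines a smooth cubic $E$ in $\mathbb{P}^2_K$ with a flex point $\mathcal{O}\in E(K)$, and set $G=G_B(K)$. Then the following hold: (1) There is $P\in E(K)\setminus E[2](K)$ with $G\cong G_{E,P}(K)$ if and only if $\mathrm{Adj}(B)\cong\mathbf{X}_1(K)$. (2) There is $P\in E[2](K)\setminus\{\mathcal{O}\}$ with $G\cong G_{E,P}(K)$ if and only if $\mathrm{Adj}(B)\cong\mathbf{S}_2(K)$.
   Context: $K[y_1,y_2,y_3]_1$ is the space of linear forms. $\mathrm{Pf}(B)$ is the Pfaffian, so $\det B=\mathrm{Pf}(B)^2$. The smooth cubic $E$ with the marked rational point $\mathcal{O}$ is regarded as an elliptic curve with identity $\mathcal{O}$; $E[2]$ is its $2$-torsion. Baer groups: for skew-symmetric $B=B_1y_1+B_2y_2+B_3y_3$ with $B_i\in\mathrm{Mat}_6(K)$, put $t_B(u,v)=(u^{\mathrm t}B_1v,u^{\mathrm t}B_2v,u^{\mathrm t}B_3v)$; $G_B(K)$ is the group on $K^6\oplus K^3$ with multiplication $(v,w)\cdot(v',w')=(v+v',w+w'+\frac12t_B(v,v'))$. The groups $G_{E,P}(K)$: since $\mathcal{O}$ is a $K$-rational flex and $\mathrm{char}(K)\notin\{2,3\}$, a $K$-linear change of coordinates of $\mathbb{P}^2_K$ puts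 $E$ into short Weierstrass form $y^2z=x^3+axz^2+bz^3$ with $\mathcal{O}\mapsto(0:1:0)$; in these coordinates, for $P=(\lambda:\mu:1)\in E(K)\setminus\{\mathcal{O}\}$, $$J_{E,P}=\begin{pmatrix} y_1-\lambda y_3 & y_2-\mu y_3 & 0\\ y_2+\mu y_3 & \lambda y_1+(a+\lambda^2)y_3 & y_1\\ 0 & y_1 & -y_3\end{pmatrix},\quad B_{E,P}=\begin{pmatrix}0 & J_{E,P}\\ -J_{E,P}^{\mathrm t} & 0\end{pmatrix},\quad G_{E,P}(K)=G_{B_{E,P}}(K).$$ Adjoint algebra: $\mathrm{Adj}(B)$ is the $K$-algebra of pairs $(\alpha,\beta)\in\mathrm{Mat}_6(K)\times\mathrm{Mat}_6(K)^{\mathrm{op}}$ with $t_B(\alpha u,v)=t_B(u,\beta v)$ for all $u,v\in K^6$, equipped with the involution $(\alpha,\beta)^*=(\beta,\alpha)$. Isomorphisms of adjoint algebras are isomorphisms of $*$-algebras (algebra isomorphisms commuting with $*$). $\mathbf{X}_1(K)$ is $K\oplus K$ with involution $(x,y)\mapsto(y,x)$. $\mathbf{S}_2(K)$ is $\mathrm{Mat}_2(K)$ with involution $X\mapsto JX^{\mathrm t}J^{-1}$, where $J=\begin{pmatrix}0&1\\-1&0\end{pmatrix}$. *)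

(* Defs.v *)
From HB Require Import structures.
From mathcomp Require Import all_boot all_order all_algebra.
From mathcomp Require Import mpoly.

Set Implicit Arguments.
Unset Strict Implicit.
Unset Printing Implicit Defensive.

Import GRing.Theory.
Local Open Scope ring_scope.

(* The library makes R^c a ring but not an algebra. *)
Section ConverseAlgebra.
Variables (R : pzRingType) (A : algType R).

HB.instance Definition _ := GRing.Nmodule_isLSemiModule.Build R A^c
  (@scalerA R A) (@scale0r R A) (@scale1r R A) (@scalerDr R A) (@scalerDl R A).

Lemma converse_scalerAl (a : R) (x y : A^c) : a *: (x * y) = (a *: x) * y.
Proof.
by change (a *: ((y : A) * x) = (y : A) * (a *: (x : A))); apply: scalerAr.
Qed.

Lemma converse_scalerAr (a : R) (x y : A^c) : a *: (x * y) = x * (a *: y).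
Proof. exact: (@scalerAl R A a y x). Qed.

HB.instance Definition _ :=
  GRing.LSemiModule_isLSemiAlgebra.Build R A^c converse_scalerAl.
HB.instance Definition _ :=
  GRing.LSemiAlgebra_isSemiAlgebra.Build R A^c converse_scalerAr.
End ConverseAlgebra.

Definition seq_mx (R : nmodType) m n (s : seq (seq R)) : 'M[R]_(m, n) :=
  \matrix_(i, j) (nth [::] s i)`_j.

(* Expansion along the first row: the j-th summand deletes the rows and      *)
(* columns of (zero-based) indices 0 and j.+1.                               *)
Fixpoint pfaffian (R : comNzRingType) (n : nat) : 'M[R]_(n.*2) -> R :=
  match n with
  | 0 => fun=> 1
  | n'.+1 => fun A : 'M[R]_(n'.*2.+2) =>
      \sum_(j < n'.*2.+1) (-1) ^+ j * A ord0 (lift ord0 j) *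
        pfaffian (row' j (row' ord0 (col' j (col' ord0 A))))
  end.

Definition on_curve (K : fieldType) (f : {mpoly K[3]}) (P : 'rV[K]_3) : bool :=
  (P != 0) && (f.@[fun i => P 0 i] == 0).

Section PlaneCubic.
Variable K : fieldType.
Implicit Types (f : {mpoly K[3]}) (P Q S T : 'rV[K]_3).

(* Points of P^2(K) are given by homogeneous coordinates, i.e. nonzero row   *)
(* vectors up to proj_eq.                                                    *)
Definition proj_eq P Q : Prop := exists2 k : K, k != 0 & P = k *: Q.

(* Smoothness is geometric, hence tested over all extension fields of K.     *)
Definition smooth_cubic f : Prop :=
  [/\ f != 0, f \is 3.-homog
    & forall (L : fieldType) (iota : {rmorphism K -> L}) (P : 'rV[L]_3),
        let fL := map_mpoly iota f in
        on_curve fL P ->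
        exists i : 'I_3, (fL^`M(i)).@[fun j => P 0 j] != 0].

(* The linear form on P^1 vanishing exactly at (p_0 : p_1). *)
Definition vanishing_form (p : 'rV[K]_2) : {mpoly K[2]} :=
  p 0 0 *: 'X_1 - p 0 1 *: 'X_0.

(* Some line meets the cubic f = 0 in the divisor P + Q + S; the line is     *)
(* parametrised as the row space of l.                                       *)
Definition line_section f P Q S : Prop :=
  exists (l : 'M[K]_(2, 3)) (p q s : 'rV[K]_2) (c : K),
    [/\ row_free l, c != 0,
        [/\ P = p *m l, Q = q *m l & S = s *m l]
      & f \mPo [tuple \sum_(k < 2) l k i *: 'X_k | i < 3] =
          c *: (vanishing_form p * vanishing_form q * vanishing_form s)].

Definition is_flex f P : Prop := on_curve f P /\ line_section f P P P.

(* T = P + Q in the chord-tangent group law of f = 0 with identity O. *)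
Definition ell_add f O P Q T : Prop :=
  exists S, [/\ on_curve f S, line_section f P Q S & line_section f O S T].

Definition two_torsion f O P : Prop := ell_add f O P P O.

Definition short_weierstrass (a b : K) : {mpoly K[3]} :=
  let x : {mpoly K[3]} := 'X_(Ordinal (isT : 0 < 3)%N) in
  let y : {mpoly K[3]} := 'X_(Ordinal (isT : 1 < 3)%N) in
  let z : {mpoly K[3]} := 'X_(Ordinal (isT : 2 < 3)%N) in
  y ^+ 2 * z - (x ^+ 3 + a *: (x * z ^+ 2) + b *: z ^+ 3).

Definition point (x y z : K) : 'rV[K]_3 := seq_mx 1 3 [:: [:: x; y; z]].

(* The change of coordinates P |-> P *m M of P^2_K puts f = 0 into short     *)
(* Weierstrass form with O at (0 : 1 : 0).                                   *)
Definition weierstrass_coords f O (M : 'M[K]_3) (a b : K) : Prop :=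
  [/\ M \in unitmx,
      exists2 c : K, c != 0 &
        f = c *: (short_weierstrass a b
                    \mPo [tuple \sum_(j < 3) M j i *: 'X_j | i < 3])
    & proj_eq (O *m M) (point 0 1 0)].

End PlaneCubic.

Section Baer.
Variable K : fieldType.

(* The parameter only selects the group structure.                           *)
Definition baer (_ : 'M[{mpoly K[3]}]_6) : Type :=
  ('cV[K]_6 * 'rV[K]_3)%type.
HB.instance Definition _ (B : 'M[{mpoly K[3]}]_6) :=
  Choice.copy (baer B) ('cV[K]_6 * 'rV[K]_3)%type.

Section Tensor.
Variable B : 'M[{mpoly K[3]}]_6.

Definition coef_mx (i : 'I_3) : 'M[K]_6 := \matrix_(j, k) (B j k)@_U_(i).

Definition tensor (u v : 'cV[K]_6) : 'rV[K]_3 :=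
  \row_i (u^T *m coef_mx i *m v) 0 0.

Lemma tensorE u v i : tensor u v 0 i = (u^T *m coef_mx i *m v) 0 0.
Proof. by rewrite mxE. Qed.

Lemma tensorDl u u' v : tensor (u + u') v = tensor u v + tensor u' v.
Proof.
by apply/rowP=> i; rewrite [RHS]mxE !tensorE linearD /= !mulmxDl mxE.
Qed.

Lemma tensorDr u v v' : tensor u (v + v') = tensor u v + tensor u v'.
Proof. by apply/rowP=> i; rewrite [RHS]mxE !tensorE mulmxDr mxE. Qed.

Lemma tensorNl u v : tensor (- u) v = - tensor u v.
Proof.
by apply/rowP=> i; rewrite [RHS]mxE !tensorE linearN /= !mulNmx mxE.
Qed.

Lemma tensorNr u v : tensor u (- v) = - tensor u v.
Proof. by apply/rowP=> i; rewrite [RHS]mxE !tensorE mulmxN mxE. Qed.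

Lemma tensor0l v : tensor 0 v = 0.
Proof. by apply/rowP=> i; rewrite [RHS]mxE tensorE trmx0 !mul0mx mxE. Qed.

Lemma tensor0r u : tensor u 0 = 0.
Proof. by apply/rowP=> i; rewrite [RHS]mxE tensorE mulmx0 mxE. Qed.

Definition baer_one : baer B := (0, 0).

Definition baer_mul (g h : baer B) : baer B :=
  (g.1 + h.1, g.2 + h.2 + 2^-1 *: tensor g.1 h.1).

(* The correction term vanishes when B is skew-symmetric and 2 != 0; with it *)
(* the group axioms hold for every B.                                        *)
Definition baer_inv (g : baer B) : baer B :=
  (- g.1, - g.2 + 2^-1 *: tensor g.1 g.1).

Lemma baer_mulA : associative baer_mul.
Proof.
move=> [u x] [v y] [w z]; rewrite /baer_mul /= addrA; congr pair.
rewrite tensorDl tensorDr !scalerDr -!addrA.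
congr (x + (y + _)); rewrite [RHS]addrCA; congr (z + _).
by rewrite [RHS]addrA addrC.
Qed.

Lemma baer_1mul : left_id baer_one baer_mul.
Proof. by case=> u x; rewrite /baer_mul /= tensor0l scaler0 addr0 !add0r. Qed.

Lemma baer_mul1 : right_id baer_one baer_mul.
Proof. by case=> u x; rewrite /baer_mul /= tensor0r scaler0 !addr0. Qed.

Lemma baer_Vmul : left_inverse baer_one baer_inv baer_mul.
Proof.
case=> u x; rewrite /baer_mul /= tensorNl scalerN addNr.
by rewrite addrAC addrK addNr.
Qed.

Lemma baer_mulV : right_inverse baer_one baer_inv baer_mul.
Proof.
case=> u x; rewrite /baer_mul /= tensorNr scalerN subrr.
by rewrite addrA addrK subrr.
Qed.

HB.instance Definition _ :=
  isGroup.Build (baer B) baer_mulA baer_1mul baer_mul1 baer_Vmul baer_mulV.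

Definition adjoint : {pred ('M[K]_6 * ('M[K]_6)^c)%type} :=
  fun x => [forall i, x.1^T *m coef_mx i == coef_mx i *m (x.2 : 'M[K]_6)].

Lemma adjointP (x : 'M[K]_6 * ('M[K]_6)^c) :
  reflect (forall u v : 'cV[K]_6,
             tensor (x.1 *m u) v = tensor u ((x.2 : 'M[K]_6) *m v))
          (x \in adjoint).
Proof.
apply: (iffP forallP) => [h u v | h i].
  apply/rowP=> i; rewrite !tensorE trmx_mul -(mulmxA _ _ (coef_mx i)) (eqP (h i)).
  by rewrite !mulmxA.
apply/eqP/matrixP=> j k.
move/rowP/(_ i): (h (delta_mx j 0) (delta_mx k 0)).
rewrite !tensorE trmx_mul trmx_delta.
rewrite -(mulmxA _ x.1^T) [in RHS]mulmxA -[in RHS](mulmxA _ (coef_mx i)).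
by rewrite -!rowE -!colE !mxE.
Qed.

Lemma adjoint_subalg : GRing.subsemialg_closed adjoint.
Proof.
split.
- by apply/adjointP=> u v /=; rewrite !mul1mx.
- split=> [|x y /adjointP hx /adjointP hy]; apply/adjointP=> u v /=.
    by rewrite !mul0mx tensor0l tensor0r.
  by rewrite !mulmxDl tensorDl tensorDr hx hy.
- move=> a x /forallP hx; apply/forallP=> i /=.
  by rewrite linearZ /= -scalemxAl -scalemxAr (eqP (hx i)).
- move=> x y /adjointP hx /adjointP hy; apply/adjointP=> u v.
  have -> : (x * y).1 = x.1 *m y.1 by [].
  have -> : (x * y).2 = (y.2 : 'M[K]_6) *m (x.2 : 'M[K]_6) by [].
  by rewrite -!mulmxA hx hy.
Qed.

HB.instance Definition _ :=
  GRing.isSubalgClosed.Build K ('M[K]_6 * ('M[K]_6)^c)%type adjoint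
    adjoint_subalg.

Record adj : Type := Adj { adj_val; adj_valP : adj_val \in adjoint }.

HB.instance Definition _ := [isSub for adj_val].
HB.instance Definition _ := [Choice of adj by <:].
HB.instance Definition _ := [SubChoice_isSubNzRing of adj by <:].
HB.instance Definition _ := [SubZmodule_isSubLmodule of adj by <:].
HB.instance Definition _ := [SubNzRing_SubLmodule_isSubLalgebra of adj by <:].
HB.instance Definition _ := [SubLalgebra_isSubAlgebra of adj by <:].

Definition adj_swap (x : adj) : 'M[K]_6 * ('M[K]_6)^c :=
  ((val x).2, (val x).1).

Lemma adj_swapP (hB : B^T = - B) (x : adj) : adj_swap x \in adjoint.
Proof.
have hC i : (coef_mx i)^T = - coef_mx i.
  by apply/matrixP=> j k; have /matrixP/(_ j k) := hB;
    rewrite !mxE => ->; rewrite mcoeffN.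
apply/forallP=> i /=; have hx := forallP (adj_valP x) i.
have := congr1 trmx (eqP hx); rewrite !trmx_mul trmxK hC.
by rewrite mulNmx mulmxN => /oppr_inj/esym/eqP.
Qed.

Definition adj_star (hB : B^T = - B) (x : adj) : adj := Adj (adj_swapP hB x).

End Tensor.
End Baer.

Definition group_iso (G H : groupType) : Prop :=
  exists phi : {multiplicative G -> H}, bijective phi.

(* Isomorphism of K-algebras equipped with the involutions s1 and s2. *)
Definition star_iso (K : fieldType) (A1 A2 : algType K)
    (s1 : A1 -> A1) (s2 : A2 -> A2) : Prop :=
  exists2 phi : {lrmorphism A1 -> A2},
    bijective phi & forall x, phi (s1 x) = s2 (phi x).

Section Models.
Variable K : fieldType.

Definition X1 : Type := (K^o * K^o)%type.
HB.instance Definition _ := GRing.Algebra.on X1.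
Definition X1_star (x : X1) : X1 := (x.2, x.1).

Definition S2 : Type := 'M[K]_2.
HB.instance Definition _ := GRing.Algebra.on S2.
Definition S2_J : 'M[K]_2 := seq_mx 2 2 [:: [:: 0; 1]; [:: -1; 0]].
Definition S2_star (X : S2) : S2 := S2_J *m (X : 'M[K]_2)^T *m invmx S2_J.

Definition J_EP (a lam mu : K) : 'M[{mpoly K[3]}]_3 :=
  let y1 : {mpoly K[3]} := 'X_(Ordinal (isT : 0 < 3)%N) in
  let y2 : {mpoly K[3]} := 'X_(Ordinal (isT : 1 < 3)%N) in
  let y3 : {mpoly K[3]} := 'X_(Ordinal (isT : 2 < 3)%N) in
  seq_mx 3 3
    [:: [:: y1 - lam *: y3; y2 - mu *: y3; 0];
        [:: y2 + mu *: y3; lam *: y1 + (a + lam ^+ 2) *: y3; y1];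
        [:: 0; y1; - y3]].

Definition B_EP (a lam mu : K) : 'M[{mpoly K[3]}]_6 :=
  block_mx 0 (J_EP a lam mu) (- (J_EP a lam mu)^T) 0 : 'M_(3 + 3).

End Models.

(* Main.v *)
From HB Require Import structures.
Require Import Defs.
From mathcomp Require Import all_boot all_order all_algebra.
From mathcomp Require Import mpoly.
From mathcomp Require Import ring.

Set Implicit Arguments.
Unset Strict Implicit.
Unset Printing Implicit Defensive.

Import GRing.Theory.
Local Open Scope ring_scope.

(** Forward direction.  Computing with the explicit tensor of [B_EP a lam mu],
    its adjoint pairs, even among additive maps that are not assumed
    [K]-linear, are the 2 x 2 matrices over [K] acting on [K^3 + K^3], with the
    off-diagonal entries killed by [mu].  An isomorphism of Baer groups
    conjugates scalars to symmetric adjoint elements, which are therefore again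
    scalars: the isomorphism is semilinear, and it carries the adjoint algebra
    of [B] to that of a twist of [B_EP a lam mu], which is [S2] if [mu = 0] and
    [X1] otherwise.  Finally [mu = 0] characterises the 2-torsion points.

    Backward direction.  Both [X1] and [S2] contain an idempotent [e] with
    [e^* = 1 - e]; it splits [K^6] into two totally isotropic subspaces of
    dimension 3, so that [B] becomes [[0, J], [- J^T, 0]] with [det J]
    proportional to the Pfaffian.  In Weierstrass coordinates the matrix [J] is
    brought to the form [J_EP] by elementary row and column operations that
    start from the value of [J] at the flex, which has rank 2; [lam] and [mu] are
    read off from the result. *)

(** * Pfaffian and determinant *)

(* The fold over [iota] makes concrete sizes computable, unlike [\sum]: this and
   [nat_pfaffian] reduce to closed expressions that [ring] can compare. *)
Fixpoint laplace_det (R : pzRingType) n (b : nat -> nat -> R) : R :=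
  if n is n'.+1 then
    foldr (fun j x => (-1) ^+ j * b 0 j *
      laplace_det n' (fun i k => b i.+1 (bump j k)) + x)
      0 (iota 0 n)
  else 1.

Lemma det_laplace (R : comNzRingType) n (b : nat -> nat -> R) :
  \det (\matrix_(i < n, j < n) b i j) = laplace_det n b.
Proof.
elim: n b => [|n IHn] b; first by rewrite det_mx00.
rewrite (expand_det_row _ ord0).
transitivity (\sum_(0 <= j < n.+1) (-1) ^+ j * b 0 j *
    laplace_det n (fun i k => b i.+1 (bump j k))).
  rewrite big_mkord; apply: eq_bigr => j _.
  rewrite /cofactor mxE add0n -IHn mulrCA mulrA.
  by congr (_ * \det _); apply/matrixP=> i k; rewrite !mxE.
by rewrite [laplace_det _ _]/= unlock /=; elim: (iota _ _) => //= j s ->.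
Qed.

Fixpoint nat_pfaffian (R : pzRingType) n (b : nat -> nat -> R) : R :=
  if n is n'.+1 then
    foldr (fun j x => (-1) ^+ j * b 0 j.+1 *
      nat_pfaffian n' (fun i k => b (bump j i).+1 (bump j k).+1) + x)
      0 (iota 0 n'.*2.+1)
  else 1.

Lemma pfaffianE (R : comNzRingType) n (b : nat -> nat -> R) :
  pfaffian (\matrix_(i < n.*2, j < n.*2) b i j) = nat_pfaffian n b.
Proof.
elim: n b => [|n IHn] b //.
transitivity (\sum_(0 <= j < n.*2.+1) (-1) ^+ j * b 0 j.+1 *
    nat_pfaffian n (fun i k => b (bump j i).+1 (bump j k).+1)).
  rewrite big_mkord [LHS]/=; apply: eq_bigr => j _.
  rewrite mxE -IHn; congr (_ * pfaffian _).
  by apply/matrixP=> i k; rewrite !mxE.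
by rewrite [nat_pfaffian _ _]/= unlock /=; elim: (iota _ _) => //= j s ->.
Qed.

(** In size 6 this is a polynomial identity in the 15 entries above the diagonal, checked by [ring]
    once both sides are unfolded on an explicit skew matrix. *)
Lemma pfaffian_sqr (R : comNzRingType) (A : 'M[R]_6) :
  A^T = - A -> (forall i, A i i = 0) -> \det A = pfaffian (n := 3) A ^+ 2.
Proof.
pose b i j := A (inord i) (inord j) => AT A0.
have b0 i : b i i = 0 by rewrite /b.
have bN i j : b j i = - b i j.
  by have /matrixP/(_ (inord i) (inord j)) := AT; rewrite !mxE.
pose e := [:: [:: 0; b 0 1; b 0 2; b 0 3; b 0 4; b 0 5];
   [:: - b 0 1; 0; b 1 2; b 1 3; b 1 4; b 1 5];
   [:: - b 0 2; - b 1 2; 0; b 2 3; b 2 4; b 2 5];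
   [:: - b 0 3; - b 1 3; - b 2 3; 0; b 3 4; b 3 5];
   [:: - b 0 4; - b 1 4; - b 2 4; - b 3 4; 0; b 4 5];
   [:: - b 0 5; - b 1 5; - b 2 5; - b 3 5; - b 4 5; 0]].
have -> : A = \matrix_(i < 6, j < 6) (nth [::] e i)`_j.
  apply/matrixP=> i j; rewrite mxE.
  have -> : A i j = b i j by rewrite /b !inord_val.
  by case: i j => [] [|[|[|[|[|[|i]]]]]] // ? [] [|[|[|[|[|[|j]]]]]] //= ?;
    rewrite -?bN ?b0.
rewrite (det_laplace 6 (fun i j => (nth [::] e i)`_j)).
rewrite (pfaffianE 3 (fun i j => (nth [::] e i)`_j)).
rewrite {}/e /=.
ring.
Qed.

Lemma det_seq_mx (R : comNzRingType) n (s : seq (seq R)) :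
  \det (seq_mx n n s) = laplace_det n (fun i j => (nth [::] s i)`_j).
Proof. exact: det_laplace. Qed.

(** * Homogeneous polynomials *)

Local Notation i0 := (Ordinal (isT : 0 < 3)%N).
Local Notation i1 := (Ordinal (isT : 1 < 3)%N).
Local Notation i2 := (Ordinal (isT : 2 < 3)%N).
Local Notation j0 := (Ordinal (isT : 0 < 2)%N).
Local Notation j1 := (Ordinal (isT : 1 < 2)%N).

Lemma sum_ord3 (V : nmodType) (F : 'I_3 -> V) :
  \sum_i F i = F i0 + F i1 + F i2.
Proof.
rewrite !big_ord_recl big_ord0 addr0 addrA.
by congr (F _ + F _ + F _); apply: val_inj.
Qed.

Lemma sum_ord2 (V : nmodType) (F : 'I_2 -> V) : \sum_i F i = F j0 + F j1.
Proof.
by rewrite !big_ord_recl big_ord0 addr0; congr (F _ + F _); apply: val_inj.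
Qed.

Lemma ord3P (P : 'I_3 -> Prop) : P i0 -> P i1 -> P i2 -> forall i, P i.
Proof.
by move=> h0 h1 h2 [[|[|[|//]]] hi];
  [move: h0 | move: h1 | move: h2]; congr P; apply: val_inj.
Qed.

Section Homogeneous.
Variable R : comNzRingType.

Lemma dhomog1E n (f : {mpoly R[n]}) :
  f \is 1.-homog -> f = \sum_i f@_U_(i) *: 'X_i.
Proof.
move=> hf; apply/mpolyP=> m; rewrite raddf_sum /=.
have [hm|hm] := eqVneq (mdeg m) 1%N; last first.
  rewrite (dhomog_nemf_coeff hf hm) big1 // => i _; rewrite mcoeffZ mcoeffX.
  have [mi|_] := eqVneq U_(i)%MM m; last by rewrite mulr0.
  by rewrite -mi mdeg1 in hm.
have /mdeg1P[i /eqP ->] : mdeg m == 1%N by rewrite hm.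
rewrite (bigD1 i) //= mcoeffZ mcoeffX eqxx mulr1 big1 ?addr0 // => j ji.
by rewrite mcoeffZ mcoeffX eq_mnm1 (negPf ji) mulr0.
Qed.

(** Each monomial of the support is assigned to one variable [h m] dividing it; [g i] collects the
    quotients of the monomials assigned to ['X_i]. *)
Lemma dhomogSE n d (f : {mpoly R[n]}) : f \is d.+1.-homog ->
  exists2 g : 'I_n -> {mpoly R[n]}, (forall i, g i \is d.-homog)
    & f = \sum_i 'X_i * g i.
Proof.
move=> /dhomogP hf.
pose h m : option 'I_n := [pick i | m i != 0%N].
have hS (m : 'X_{1..n}) i : m i != 0%N -> m = (U_(i) + (m - U_(i)))%MM.
  by move=> mi; rewrite addmC submK // lep1mP.
exists (fun i => \sum_(m <- msupp f | h m == Some i) f@_m *: 'X_[m - U_(i)]).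
  move=> i; rewrite big_seq_cond; apply: rpred_sum => m /andP[/hf /= hm].
  rewrite /h; case: pickP => // j mj /eqP[<-]; apply: dhomogZ.
  by rewrite dhomogX /= -(eqn_add2l 1) -{1}(mdeg1 j) -mdegD -hS //; apply/eqP.
rewrite [LHS]mpolyE; under [RHS]eq_bigr do rewrite mulr_sumr.
rewrite (exchange_big_dep xpredT) //= !big_seq; apply: eq_bigr => m /hf /= hm.
rewrite /h; case: pickP => [i mi|m0].
  rewrite (big_pred1 i) => [|j]; last by rewrite [LHS]eq_sym.
  by rewrite -scalerAr -mpolyXD -hS.
by move: hm; rewrite mdegE big1 // => i _; move/eqP: (m0 i).
Qed.

Lemma dhomog3E n (f : {mpoly R[n]}) : f \is 3.-homog ->
  exists c : 'I_n -> 'I_n -> 'I_n -> R,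
    f = \sum_i \sum_j \sum_k c i j k *: ('X_i * 'X_j * 'X_k).
Proof.
case/dhomogSE=> g hg ->.
have /fin_all_exists2[h hh gE] i := dhomogSE (hg i).
exists (fun i j k => (h i j)@_U_(k)); apply: eq_bigr => i _.
rewrite gE mulr_sumr; apply: eq_bigr => j _.
rewrite {1}(dhomog1E (hh i j)) !mulr_sumr; apply: eq_bigr => k _.
by rewrite -!scalerAr mulrA.
Qed.

Lemma dhomog_comp n m d (f : {mpoly R[n]}) (t : n.-tuple {mpoly R[m]}) :
  f \is d.-homog -> (forall i, tnth t i \is 1.-homog) -> f \mPo t \is d.-homog.
Proof.
move=> /dhomogP hf ht; rewrite comp_mpolyE big_seq; apply: rpred_sum => k /hf /= <-.
apply: dhomogZ; rewrite mdegE.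
elim/big_ind2: _ => [|p1 d1 p2 d2|i _]; first exact: dhomog1.
  exact: dhomogM.
by rewrite -[X in X.-homog]mul1n; apply: dhomogMn.
Qed.

End Homogeneous.

Section CubicForms.
Variable K : fieldType.

Lemma ternary_cubicE (f : {mpoly K[3]}) : f \is 3.-homog ->
  exists c300 c030 c003 c210 c201 c120 c021 c102 c012 c111 : K,
    f = c300 *: 'X_i0 ^+ 3 + c030 *: 'X_i1 ^+ 3 + c003 *: 'X_i2 ^+ 3
      + c210 *: ('X_i0 ^+ 2 * 'X_i1) + c201 *: ('X_i0 ^+ 2 * 'X_i2)
      + c120 *: ('X_i0 * 'X_i1 ^+ 2) + c021 *: ('X_i1 ^+ 2 * 'X_i2)
      + c102 *: ('X_i0 * 'X_i2 ^+ 2) + c012 *: ('X_i1 * 'X_i2 ^+ 2)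
      + c111 *: ('X_i0 * 'X_i1 * 'X_i2).
Proof.
case/dhomog3E=> c ->.
exists (c i0 i0 i0), (c i1 i1 i1), (c i2 i2 i2),
  (c i0 i0 i1 + c i0 i1 i0 + c i1 i0 i0), (c i0 i0 i2 + c i0 i2 i0 + c i2 i0 i0),
  (c i0 i1 i1 + c i1 i0 i1 + c i1 i1 i0), (c i1 i1 i2 + c i1 i2 i1 + c i2 i1 i1),
  (c i0 i2 i2 + c i2 i0 i2 + c i2 i2 i0), (c i1 i2 i2 + c i2 i1 i2 + c i2 i2 i1),
  (c i0 i1 i2 + c i0 i2 i1 + c i1 i0 i2 + c i1 i2 i0 + c i2 i0 i1 + c i2 i1 i0).
rewrite !sum_ord3 -!mul_mpolyC !mpolyCD; ring.
Qed.

Lemma binary_cubicE (f : {mpoly K[2]}) : f \is 3.-homog ->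
  exists c30 c21 c12 c03 : K,
    f = c30 *: 'X_j0 ^+ 3 + c21 *: ('X_j0 ^+ 2 * 'X_j1)
      + c12 *: ('X_j0 * 'X_j1 ^+ 2) + c03 *: 'X_j1 ^+ 3.
Proof.
case/dhomog3E=> c ->.
exists (c j0 j0 j0), (c j0 j0 j1 + c j0 j1 j0 + c j1 j0 j0),
  (c j0 j1 j1 + c j1 j0 j1 + c j1 j1 j0), (c j1 j1 j1).
rewrite !sum_ord2 -!mul_mpolyC !mpolyCD; ring.
Qed.

Hypothesis two_neq0 : 2 != 0 :> K.

Lemma addsub_eq0 (x y : K) : x + y = 0 -> x - y = 0 -> x = 0 /\ y = 0.
Proof.
move=> hD hB; have x0 : x = 0.
  apply: (mulfI two_neq0); rewrite mulr0 -[RHS]addr0 -{1}hD -hB; ring.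
by move: hD; rewrite x0 add0r.
Qed.

Definition coords3 (x y z : K) (i : 'I_3) : K := [:: x; y; z]`_i.
Definition coords2 (x y : K) (i : 'I_2) : K := [:: x; y]`_i.

(** [K] may be finite, so a form vanishing at all points has to be shown zero by hand: points with
    coordinates 0, 1, -1 determine the ten coefficients, because 2 is invertible. *)
Lemma ternary_cubic_eq0 (f : {mpoly K[3]}) :
  f \is 3.-homog -> (forall x y z, f.@[coords3 x y z] = 0) -> f = 0.
Proof.
case/ternary_cubicE=> c300 [c030 [c003 [c210 [c201 [c120 [c021 [c102
  [c012 [c111 ->]]]]]]]]].
move=> h.
have {}h x y z : c300 * x ^+ 3 + c030 * y ^+ 3 + c003 * z ^+ 3
    + c210 * (x ^+ 2 * y) + c201 * (x ^+ 2 * z) + c120 * (x * y ^+ 2)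
    + c021 * (y ^+ 2 * z) + c102 * (x * z ^+ 2) + c012 * (y * z ^+ 2)
    + c111 * (x * y * z) = 0.
  rewrite -[RHS](h x y z) !exprS !expr0 !mulr1 !mevalD !mevalZ !mevalM !mevalXU /coords3 /=.
  by ring.
have e1 : c300 = 0 by rewrite -(h 1 0 0); ring.
have e2 : c030 = 0 by rewrite -(h 0 1 0); ring.
have e3 : c003 = 0 by rewrite -(h 0 0 1); ring.
move: h; rewrite {}e1 {}e2 {}e3 => h.
have [e1 e2] : c120 = 0 /\ c210 = 0.
  by apply: addsub_eq0; [rewrite -(h 1 1 0) | rewrite -(h 1 (-1) 0)]; ring.
have [e3 e4] : c102 = 0 /\ c201 = 0.
  by apply: addsub_eq0; [rewrite -(h 1 0 1) | rewrite -(h 1 0 (-1))]; ring.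
have [e5 e6] : c012 = 0 /\ c021 = 0.
  by apply: addsub_eq0; [rewrite -(h 0 1 1) | rewrite -(h 0 1 (-1))]; ring.
move: h; rewrite {}e1 {}e2 {}e3 {}e4 {}e5 {}e6 => h.
have -> : c111 = 0 by rewrite -(h 1 1 1); ring.
by rewrite !scale0r !addr0.
Qed.

Lemma binary_cubic_eq0 (f : {mpoly K[2]}) :
  f \is 3.-homog -> (forall x y, f.@[coords2 x y] = 0) -> f = 0.
Proof.
case/binary_cubicE=> c30 [c21 [c12 [c03 ->]]] h.
have {}h x y : c30 * x ^+ 3 + c21 * (x ^+ 2 * y) + c12 * (x * y ^+ 2)
    + c03 * y ^+ 3 = 0.
  rewrite -[RHS](h x y) !exprS !expr0 !mulr1 !mevalD !mevalZ !mevalM !mevalXU /coords2 /=.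
  by ring.
have e1 : c30 = 0 by rewrite -(h 1 0); ring.
have e2 : c03 = 0 by rewrite -(h 0 1); ring.
move: h; rewrite {}e1 {}e2 => h.
have [-> ->] : c12 = 0 /\ c21 = 0.
  by apply: addsub_eq0; [rewrite -(h 1 1) | rewrite -(h 1 (-1))]; ring.
by rewrite !scale0r !addr0.
Qed.

End CubicForms.

(** The coordinates of the generic row vector times [M]: the substitution occurring in
    [line_section] and [weierstrass_coords]. *)
Definition lin_tuple (K : nzRingType) m n (M : 'M[K]_(m, n)) : n.-tuple {mpoly K[m]} :=
  [tuple \sum_(j < m) M j i *: 'X_j | i < n].

Definition row_eval (K : nzRingType) n (f : {mpoly K[n]}) (y : 'rV[K]_n) : K :=
  f.@[fun i => y 0 i].

Section Forms.
Variable K : fieldType.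
Implicit Types (f : {mpoly K[3]}) (O y v : 'rV[K]_3).

Lemma row_eval_comp m n (f : {mpoly K[n]}) (M : 'M[K]_(m, n)) (y : 'rV_m) :
  row_eval (f \mPo lin_tuple M) y = row_eval f (y *m M).
Proof.
rewrite /row_eval comp_mpoly_meval; apply: meval_eq => i.
rewrite tnth_mktuple raddf_sum mxE; apply: eq_bigr => j _ /=.
by rewrite mevalZ mevalXU mulrC.
Qed.

Lemma lin_tuple_comp_homog m n d (f : {mpoly K[n]}) (M : 'M[K]_(m, n)) :
  f \is d.-homog -> f \mPo lin_tuple M \is d.-homog.
Proof.
move=> hf; apply: dhomog_comp => // i; rewrite tnth_mktuple.
by apply: rpred_sum => j _; apply: dhomogZ; rewrite dhomogX /= mdeg1.
Qed.

Lemma row_eval_point f (x y z : K) : f.@[coords3 x y z] = row_eval f (point x y z).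
Proof.
apply: meval_eq; apply: ord3P; by rewrite mxE.
Qed.

Lemma row3E y : y = point (y 0 i0) (y 0 i1) (y 0 i2).
Proof. by apply/rowP; apply: ord3P; rewrite mxE. Qed.

Lemma row_eval_cubic f : f \is 3.-homog ->
  exists c300 c030 c003 c210 c201 c120 c021 c102 c012 c111 : K, forall y,
    row_eval f y = c300 * y 0 i0 ^+ 3 + c030 * y 0 i1 ^+ 3 + c003 * y 0 i2 ^+ 3
      + c210 * (y 0 i0 ^+ 2 * y 0 i1) + c201 * (y 0 i0 ^+ 2 * y 0 i2)
      + c120 * (y 0 i0 * y 0 i1 ^+ 2) + c021 * (y 0 i1 ^+ 2 * y 0 i2)
      + c102 * (y 0 i0 * y 0 i2 ^+ 2) + c012 * (y 0 i1 * y 0 i2 ^+ 2)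
      + c111 * (y 0 i0 * y 0 i1 * y 0 i2).
Proof.
case/ternary_cubicE=> c300 [c030 [c003 [c210 [c201 [c120 [c021 [c102
  [c012 [c111 ->]]]]]]]]].
exists c300, c030, c003, c210, c201, c120, c021, c102, c012, c111 => y.
rewrite /row_eval !exprS !expr0 !mulr1 !mevalD !mevalZ !mevalM !mevalXU; ring.
Qed.

Lemma cubic_inj f g : 2 != 0 :> K -> f \is 3.-homog -> g \is 3.-homog ->
  row_eval f =1 row_eval g -> f = g.
Proof.
move=> two_neq0 hf hg fg; apply/eqP; rewrite -subr_eq0; apply/eqP.
apply: (ternary_cubic_eq0 two_neq0) => [|x y z]; first exact: rpredB.
by rewrite mevalB !row_eval_point fg subrr.
Qed.

Lemma row_eval_weierstrass (a b : K) y :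
  row_eval (short_weierstrass a b) y = y 0 i1 ^+ 2 * y 0 i2 -
    (y 0 i0 ^+ 3 + a * (y 0 i0 * y 0 i2 ^+ 2) + b * y 0 i2 ^+ 3).
Proof.
rewrite /row_eval /short_weierstrass !exprS !expr0 !mulr1.
rewrite !mevalB !mevalD !mevalZ !mevalM !mevalXU; ring.
Qed.

Lemma weierstrass_homog (a b : K) : short_weierstrass a b \is 3.-homog.
Proof.
have hX i : ('X_i : {mpoly K[3]}) \is 1.-homog by rewrite dhomogX /= mdeg1.
rewrite /short_weierstrass; apply: rpredB; last apply: rpredD; first last.
- by apply: dhomogZ; apply: (dhomogMn 3 (hX _)).
- apply: rpredD; first exact: (dhomogMn 3 (hX _)).
  by apply: dhomogZ; apply: (dhomogM (hX _) (dhomogMn 2 (hX _))).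
- by apply: (dhomogM (dhomogMn 2 (hX _)) (hX _)).
Qed.

Lemma mderivXU n (i j : 'I_n) : ('X_i : {mpoly K[n]})^`M(j) = (i == j)%:R.
Proof.
rewrite mderivX mnm1E; case: eqP => [->|_]; last by rewrite scale0r.
rewrite scale1r (_ : (_ - _)%MM = 0%MM) ?mpolyX0 //.
by apply/mnmP=> k; rewrite mnmBE subnn mnm0E.
Qed.

(** In the expansion of [f] at [p + t v], half the difference between t = 1 and t = -1 keeps the odd
    terms: the derivative along [v] and the cubic term [f v]. Both sides are additive in [f], so
    monomials suffice. *)
Lemma cubic_gradient n (f : {mpoly K[n]}) (p v : 'rV_n) :
  2 != 0 :> K -> f \is 3.-homog ->
  \sum_i v 0 i * row_eval f^`M(i) p =
  (row_eval f (p + v) - row_eval f (p - v)) / 2 - row_eval f v.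
Proof.
move=> two_neq0 /dhomog3E[c ->]; set P := fun g : {mpoly K[n]} =>
  \sum_i v 0 i * row_eval g^`M(i) p =
  (row_eval g (p + v) - row_eval g (p - v)) / 2 - row_eval g v.
have P0 : P 0.
  rewrite /P /row_eval !meval0 subrr mul0r subrr big1 // => i _.
  by rewrite mderiv0 meval0 mulr0.
have PD g h : P g -> P h -> P (g + h).
  rewrite /P /row_eval !mevalD => Pg Ph.
  under eq_bigr do rewrite mderivD mevalD mulrDr.
  by rewrite big_split Pg Ph /=; ring.
have delta j : \sum_i v 0 i * (j == i)%:R = v 0 j.
  rewrite (bigD1 j) //= eqxx mulr1 big1 ?addr0 // => i ij.
  by rewrite eq_sym (negPf ij) mulr0.
apply: (big_ind P) => // i _; apply: (big_ind P) => // j _.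
apply: (big_ind P) => // k _; rewrite /P /row_eval.
transitivity (\sum_m (c i j k * p 0 j * p 0 k * (v 0 m * (i == m)%:R) +
    c i j k * p 0 i * p 0 k * (v 0 m * (j == m)%:R) +
    c i j k * p 0 i * p 0 j * (v 0 m * (k == m)%:R))).
  apply: eq_bigr => m _.
  rewrite mderivZ mevalZ 2!mderivM !mderivXU mevalD !mevalM mevalD !mevalM.
  by rewrite !mevalXU !mevalMn !meval1; ring.
rewrite !big_split -!mulr_sumr !delta /= !mevalZ !mevalM !mevalXU !mxE.
by field.
Qed.

End Forms.

(** * Weierstrass coordinates and 2-torsion *)

(** The value of [vanishing_form p] at [t]. *)
Definition wedge (K : pzRingType) (p t : 'rV[K]_2) : K := p 0 0 * t 0 1 - p 0 1 * t 0 0.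

Section Wedge.
Variable K : fieldType.
Implicit Types (p q t : 'rV[K]_2).

Lemma wedgeC p t : wedge t p = - wedge p t.
Proof. by rewrite /wedge; ring. Qed.

Lemma wedgeDr p q t : wedge p (q + t) = wedge p q + wedge p t.
Proof. by rewrite /wedge !mxE; ring. Qed.

Lemma wedgeZr p (a : K) t : wedge p (a *: t) = a * wedge p t.
Proof. by rewrite /wedge !mxE; ring. Qed.

Lemma wedgepp p : wedge p p = 0.
Proof. by rewrite /wedge; ring. Qed.

Lemma wedge_dual p : p != 0 -> exists q, wedge p q = 1.
Proof.
move=> p0; have [p00|p00] := eqVneq (p 0 0) 0; last first.
  exists (\row_j ((j == 1)%:R / p 0 0)).
  by rewrite /wedge !mxE /=; field.
have p01 : p 0 1 != 0.
  apply: contraNneq p0 => p01; apply/eqP/rowP => -[[|[|//]] hi]; rewrite !mxE.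
    by rewrite -[RHS]p00; congr (p _ _); apply: val_inj.
  by rewrite -[RHS]p01; congr (p _ _); apply: val_inj.
exists (\row_j (- (j == 0)%:R / p 0 1)).
by rewrite /wedge !mxE /=; field.
Qed.

Lemma line_section_eval (f : {mpoly K[3]}) (l : 'M_(2, 3)) p q s (c : K) :
  f \mPo lin_tuple l =
    c *: (vanishing_form p * vanishing_form q * vanishing_form s) ->
  forall t, row_eval f (t *m l) = c * (wedge p t * wedge q t * wedge s t).
Proof.
move=> h t; rewrite -row_eval_comp h /row_eval mevalZ !mevalM.
by rewrite /vanishing_form !mevalB !mevalZ !mevalXU.
Qed.

End Wedge.

Section Weierstrass.
Variable K : fieldType.
Implicit Types (f : {mpoly K[3]}) (O : 'rV[K]_3).

Lemma mulmx_row3 m (y : 'rV[K]_3) (A : 'M[K]_(3, m)) :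
  y *m A = y 0 i0 *: row i0 A + y 0 i1 *: row i1 A + y 0 i2 *: row i2 A.
Proof. by rewrite mulmx_sum_row sum_ord3. Qed.

(** A frame in which the flex is (0 : 1 : 0) and its tangent is z = 0. Triple contact at the flex
    leaves only the cube of [x] on the tangent. *)
Lemma flex_frame f O : is_flex f O ->
  exists A : 'M[K]_3, exists2 c : K, A \in unitmx /\ c != 0 &
    row i1 A = O /\ forall x y, row_eval f (point x y 0 *m A) = c * x ^+ 3.
Proof.
case=> /andP[O0 _] [l [p [q [s [c [lfree c0 [hp hq hs] hf]]]]]].
have {hq} qp : q = p by apply: (row_free_inj lfree); rewrite /= -hp.
have {hs} sp : s = p by apply: (row_free_inj lfree); rewrite /= -hp.
rewrite {}qp {}sp in hf.
have p0 : p != 0 by apply: contraNneq O0 => p0; rewrite hp p0 mul0mx.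
have [p' pp'] := wedge_dual p0.
have [i Ri] : exists i, ~~ (row i (1%:M : 'M[K]_3) <= l)%MS.
  apply/row_subPn; apply/negP => /mxrankS; rewrite mxrank1.
  by rewrite (eqP lfree).
set R := row i _ in Ri.
(* The rows are a second point of the tangent, the flex, and a standard basis vector off the
   tangent. *)
pose A : 'M[K]_3 := \matrix_(k < 3) nth 0 [:: p' *m l; O; R] k.
have AE y : y *m A = y 0 i0 *: (p' *m l) + y 0 i1 *: O + y 0 i2 *: R.
  by rewrite mulmx_row3 !rowK.
exists A, c; split=> //.
  rewrite -row_free_unit -kermx_eq0; apply/rowV0P => v /sub_kermxP.
  rewrite AE => vA.
  have v2 : v 0 i2 = 0.
    apply: contraNeq Ri => v2.
    have -> : R = - (v 0 i2)^-1 *: ((v 0 i0 *: p' + v 0 i1 *: p) *m l).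
      apply: (scalerI v2); rewrite scalerA mulrN divff // scaleN1r.
      rewrite mulmxDl -!scalemxAl -hp; apply/eqP.
      by rewrite -subr_eq0 opprK addrC vA.
    by rewrite scalemx_sub // submxMl.
  move: vA; rewrite v2 scale0r addr0 hp !scalemxAl -mulmxDl -[RHS](mul0mx _ l).
  move/(row_free_inj lfree) => vp.
  have v0 : v 0 i0 = 0.
    have := congr1 (wedge p) vp; rewrite wedgeDr !wedgeZr wedgepp pp'.
    by rewrite mulr1 mulr0 addr0 => ->; rewrite /wedge !mxE; ring.
  move/eqP: vp; rewrite v0 scale0r add0r scaler_eq0 (negPf p0) orbF => /eqP v1.
  by rewrite [v]row3E v0 v1 v2; apply/rowP; apply: ord3P; rewrite !mxE.
  by rewrite rowK.
move=> x y; rewrite AE !mxE /= scale0r addr0 hp !scalemxAl -mulmxDl.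
by rewrite (line_section_eval hf) wedgeDr !wedgeZr pp' wedgepp; ring.
Qed.

(** In the frame of [flex_frame] the monomials [y^3], [x y^2], [x^2 y] are absent, and smoothness at
    the flex makes the coefficient of [y^2 z] nonzero. One completes the square in [y] and the cube
    in [x], dividing by 2 and 3, and rescales [z]. *)
Lemma weierstrass_exists f O : 6%:R != 0 :> K -> smooth_cubic f -> is_flex f O ->
  exists (M : 'M[K]_3) (a b : K), weierstrass_coords f O M a b.
Proof.
move=> six_neq0 [f0 hf smooth] hO.
have two_neq0 : 2 != 0 :> K.
  by apply: contraNneq six_neq0 => h; rewrite (natrM K 2 3) h mul0r.
have three_neq0 : 3 != 0 :> K.
  by apply: contraNneq six_neq0 => h; rewrite (natrM K 2 3) h mulr0.
have [A [c [Aunit c0] [AO Ac]]] := flex_frame hO.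
have [c300 [c030 [c003 [c210 [c201 [c120 [c021 [c102 [c012 [c111 gE]]]]]]]]]] :=
  row_eval_cubic (lin_tuple_comp_homog A hf).
have {}Ac x y : c300 * x ^+ 3 + c030 * y ^+ 3 + c210 * (x ^+ 2 * y)
    + c120 * (x * y ^+ 2) = c * x ^+ 3.
  by rewrite -(Ac x y) -row_eval_comp gE !mxE /=; ring.
have e1 : c300 = c by transitivity (c * 1 ^+ 3); [rewrite -(Ac 1 0)|]; ring.
have e2 : c030 = 0 by transitivity (c * 0 ^+ 3); [rewrite -(Ac 0 1)|]; ring.
rewrite {}e1 {}e2 in Ac gE.
have [e1 e2] : c120 = 0 /\ c210 = 0.
  apply: (addsub_eq0 two_neq0); apply: (addrI c).
    by transitivity (c * 1 ^+ 3); [rewrite -(Ac 1 1)|]; ring.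
  by transitivity (c * 1 ^+ 3); [rewrite -(Ac 1 (-1))|]; ring.
rewrite {}e1 {}e2 {Ac} in gE.
have {}gE x y z : row_eval f (point x y z *m A) =
    c * x ^+ 3 + c003 * z ^+ 3 + c201 * (x ^+ 2 * z) + c021 * (y ^+ 2 * z)
    + c102 * (x * z ^+ 2) + c012 * (y * z ^+ 2) + c111 * (x * y * z).
  by rewrite -row_eval_comp gE !mxE /=; ring.
have OE : O = point 0 1 0 *m A.
  by rewrite mulmx_row3 !mxE /= !scale0r scale1r add0r addr0.
(* By [cubic_gradient] the derivative at [O] in the direction (x, y, z) of the frame is [c021 * z];
   were [c021] zero, the gradient would vanish, against smoothness over [K] itself. *)
have c021_neq0 : c021 != 0.
  have map_id : map_mpoly idfun f = f.
    by apply/mpolyP=> m; rewrite mcoeff_map_mpoly.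
  have := smooth K idfun O; rewrite /= map_id => /(_ hO.1)[i].
  apply: contraNneq => c021_0.
  have grad0 x y z : \sum_i (point x y z *m A) 0 i * row_eval f^`M(i) O = 0.
    rewrite cubic_gradient // OE -mulmxDl -mulmxBl.
    have -> : point 0 1 0 + point x y z = point x (1 + y) z.
      by apply/rowP; apply: ord3P; rewrite !mxE /= ?add0r.
    have -> : point 0 1 0 - point x y z = point (- x) (1 - y) (- z).
      by apply/rowP; apply: ord3P; rewrite !mxE /= ?sub0r.
    by rewrite !gE c021_0; field.
  rewrite -[_.@[_]]/(row_eval f^`M(i) O).
  have := grad0 (invmx A i i0) (invmx A i i1) (invmx A i i2).
  (* Row [i] of [invmx A] is the direction which [A] sends to the [i]-th standard vector, so it
     isolates the [i]-th partial derivative. *)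
  have -> : point (invmx A i i0) (invmx A i i1) (invmx A i i2) = row i (invmx A).
    by apply/rowP; apply: ord3P; rewrite !mxE.
  rewrite -row_mul mulVmx // (bigD1 i) //= !mxE eqxx mul1r big1 ?addr0 => [->//|j ji].
  by rewrite !mxE eq_sym (negPf ji) mul0r.
(* With the square in [y] completed, [x + be * z] absorbs the term in [x^2 z]; [d] and [e] are the
   coefficients of [x z^2] and [z^3] that remain. *)
pose be := (c201 - c111 ^+ 2 / (4 * c021)) / (3 * c).
pose d := c102 - c111 * c012 / (2 * c021) - 3 * c * be ^+ 2.
pose e := c003 - c012 ^+ 2 / (4 * c021) - c * be ^+ 3 - be * d.
pose N : 'M[K]_3 := seq_mx 3 3
  [:: [:: 1; c111 / (2 * c021); 0];
      [:: 0; 1; 0];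
      [:: be; c012 / (2 * c021); - (c021 / c)]].
have NE x y z : point x y z *m N = point (x + be * z)
    (y + (c111 * x + c012 * z) / (2 * c021)) (- (c021 / c) * z).
  apply/rowP; apply: ord3P; rewrite !mxE sum_ord3 !mxE /=;
    by field; rewrite ?c0 ?c021_neq0 ?two_neq0.
have Nunit : N \in unitmx.
  rewrite unitmxE det_seq_mx /= unitfE.
  rewrite (_ : _ + _ = - (c021 / c)); last ring.
  by rewrite oppr_eq0 mulf_neq0 ?invr_eq0.
have fE y : row_eval f y = - c * row_eval
    (short_weierstrass (d * c / c021 ^+ 2) (- (e * c ^+ 2 / c021 ^+ 3)))
    (y *m (invmx A *m N)).
  have -> : y = y *m invmx A *m A by rewrite mulmxKV.
  rewrite mulmxA !mulmxK // [y *m invmx A]row3E.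
  move: (y *m invmx A) => v; rewrite gE NE row_eval_weierstrass !mxE /= /e /d /be.
  by field; rewrite c0 c021_neq0 three_neq0 two_neq0 (natrM K 2 2) mulf_neq0.
exists (invmx A *m N), (d * c / c021 ^+ 2), (- (e * c ^+ 2 / c021 ^+ 3)); split.
- by rewrite unitmx_mul unitmx_inv Aunit.
- exists (- c); first by rewrite oppr_eq0.
  apply: cubic_inj => // [|y].
    exact/dhomogZ/lin_tuple_comp_homog/weierstrass_homog.
  by rewrite fE {2}/row_eval mevalZ -row_eval_comp.
exists 1; rewrite ?oner_eq0 // scale1r OE mulmxA mulmxK // NE.
by congr point; ring.
Qed.

Lemma weierstrass_eval f O M a b : weierstrass_coords f O M a b ->
  exists2 c : K, c != 0 & forall y, row_eval f y =
    c * ((y *m M) 0 i1 ^+ 2 * (y *m M) 0 i2 - ((y *m M) 0 i0 ^+ 3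
      + a * ((y *m M) 0 i0 * (y *m M) 0 i2 ^+ 2) + b * (y *m M) 0 i2 ^+ 3)).
Proof.
case=> _ [c c0 ->] _; exists c => // y.
by rewrite -row_eval_weierstrass -row_eval_comp {1}/row_eval mevalZ.
Qed.

Lemma scaled_point (k x y z : K) : k *: point x y z = point (k * x) (k * y) (k * z).
Proof. by apply/rowP; apply: ord3P; rewrite !mxE. Qed.

Lemma addr_point (x y z x' y' z' : K) :
  point x y z + point x' y' z' = point (x + x') (y + y') (z + z').
Proof. by apply/rowP; apply: ord3P; rewrite !mxE. Qed.

Lemma pointE (x y z : K) : (point x y z 0 i0 = x) * (point x y z 0 i1 = y) *
  (point x y z 0 i2 = z).
Proof. by rewrite !mxE. Qed.

Lemma wedge_neq0_parallel (p q : 'rV[K]_2) : p != 0 -> wedge p q = 0 ->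
  exists k, q = k *: p.
Proof.
move=> p0 pq; have [p' pp'] := wedge_dual p0.
exists (- wedge p' q).
have c0 : wedge p p' *: q = wedge p q *: p' - wedge p' q *: p.
  apply/rowP=> -[[|[|//]] hi]; rewrite !mxE /wedge.
    by rewrite (_ : Ordinal hi = 0); [ring | apply: val_inj].
  by rewrite (_ : Ordinal hi = 1); [ring | apply: val_inj].
by move: c0; rewrite pp' pq scale1r scale0r sub0r scaleNr.
Qed.

Lemma vanishing_form_homog (p : 'rV[K]_2) : vanishing_form p \is 1.-homog.
Proof. by apply: rpredB; apply: dhomogZ; rewrite dhomogX /= mdeg1. Qed.

(** Both sides of the identity in [line_section] are binary cubics, so comparing values is
    enough. *)
Lemma line_sectionI f (l : 'M[K]_(2, 3)) p q s c : 2 != 0 :> K ->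
  f \is 3.-homog -> row_free l -> c != 0 ->
  (forall t, row_eval f (t *m l) = c * (wedge p t * wedge q t * wedge s t)) ->
  line_section f (p *m l) (q *m l) (s *m l).
Proof.
move=> two_neq0 hf lfree c0 h; exists l, p, q, s, c; split=> //.
apply/eqP; rewrite -subr_eq0; apply/eqP; apply: (binary_cubic_eq0 two_neq0).
  apply: rpredB; first exact: lin_tuple_comp_homog.
  have hv := vanishing_form_homog.
  exact/dhomogZ/(dhomogM (dhomogM (hv p) (hv q)) (hv s)).
move=> x y; have := h (\row_i coords2 x y i); rewrite -row_eval_comp => {}h.
apply/eqP; rewrite mevalB subr_eq0; apply/eqP.
transitivity (row_eval (f \mPo lin_tuple l) (\row_i coords2 x y i)).
  by apply: meval_eq => i; rewrite mxE.
rewrite h mevalZ !mevalM /vanishing_form !mevalB !mevalZ !mevalXU.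
by rewrite /wedge !mxE.
Qed.

(** If 2P = O, the auxiliary point [S] lies on the tangent at the flex, hence equals [O]; so the
    tangent at [P] passes through (0 : 1 : 0), which forces [mu = 0]. Conversely, for [mu = 0] the
    line through [P] and [O] is tangent at [P]. *)
Lemma two_torsion_mu f O M a b P (lam mu : K) : 2 != 0 :> K -> f \is 3.-homog ->
  is_flex f O -> weierstrass_coords f O M a b -> on_curve f P ->
  proj_eq (P *m M) (point lam mu 1) -> two_torsion f O P <-> mu = 0.
Proof.
move=> two_neq0 hf hO hW; have [c c0 fE] := weierstrass_eval hW.
case: hW => Munit _ [kO kO0 OM] /andP[P0 /eqP fP] [k k0 PM].
have muE : mu ^+ 2 = lam ^+ 3 + a * lam + b.
  have := fP; rewrite -/(row_eval f P) fE PM !scaled_point !pointE.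
  move/eqP; rewrite mulf_eq0 (negPf c0) /= => /eqP e.
  apply: (mulfI (expf_neq0 3 k0)); apply/eqP; rewrite -subr_eq0 -[X in _ == X]e.
  by apply/eqP; ring.
split.
  case=> S [/andP[S0 _] [l [p [q [s [d [lfree d0 [hp hq hs] hl]]]]]]].
  case=> l' [p' [q' [s' [d' [lfree' d0' [hp' hq' hs'] hl']]]]].
  have [kap Skap] : exists kap, S = kap *: O.
    have sp : s' = p' by apply: (row_free_inj lfree'); rewrite /= -hs'.
    have p0 : p' != 0.
      apply: contraNneq (k0) => p0.
      move: OM; rewrite hp' p0 !mul0mx scaled_point => /rowP/(_ i1).
      by rewrite !mxE mulr1 => /esym/eqP; rewrite (negPf kO0).
    have [r pr] := wedge_dual p0.
    have [kap qk] : exists kap, q' = kap *: p'; last first.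
      by exists kap; rewrite hq' qk -scalemxAl -hp'.
    apply: wedge_neq0_parallel => //.
    have [x [y [z R]]] : exists x y z, r *m l' *m M = point x y z.
      by exists ((r *m l' *m M) 0 i0), ((r *m l' *m M) 0 i1), ((r *m l' *m M) 0 i2);
        exact: row3E.
    have hE al be : c * ((al * kO + be * y) ^+ 2 * (be * z) - ((be * x) ^+ 3 +
        a * (be * x * (be * z) ^+ 2) + b * (be * z) ^+ 3)) =
        d' * (be ^+ 2 * (al * wedge q' p' + be * wedge q' r)).
      have := line_section_eval hl' (al *: p' + be *: r).
      rewrite fE !mulmxDl -!scalemxAl -hp' OM R !scaled_point addr_point !pointE.
      rewrite sp !wedgeDr !wedgeZr wedgepp pr !(mulr0, add0r, mulr1) => e.
      by apply: (etrans _ (etrans e _)); ring.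
    (* The right side of [hE] has degree at most 1 in [al], so the second difference in [al]
       isolates the coefficient of [al^2] on the left: the line is z = 0. *)
    have z0 : z = 0.
      have e : c * (2 * kO ^+ 2 * z) = 0.
        transitivity (d' * (1 ^+ 2 * (1 * wedge q' p' + 1 * wedge q' r))
          + d' * (1 ^+ 2 * (-1 * wedge q' p' + 1 * wedge q' r))
          - 2 * (d' * (1 ^+ 2 * (0 * wedge q' p' + 1 * wedge q' r)))).
          by rewrite -!hE; ring.
        by ring.
      apply/eqP; move/eqP: e.
      by rewrite !mulf_eq0 (negPf c0) (negPf two_neq0) (negPf kO0).
    (* With [z = 0] the left side of [hE] does not depend on [al], so the coefficient [wedge q' p']
       of [al] vanishes. *)
    apply/eqP; rewrite wedgeC oppr_eq0 -(mulrI_eq0 _ (mulfI d0')); apply/eqP.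
    transitivity (d' * (1 ^+ 2 * (1 * wedge q' p' + 1 * wedge q' r))
      - d' * (1 ^+ 2 * (0 * wedge q' p' + 1 * wedge q' r))); first by ring.
    by rewrite -!hE z0; ring.
  have kap0 : kap != 0 by apply: contraNneq S0 => k1; rewrite Skap k1 scale0r.
  have {hq} qp : q = p by apply: (row_free_inj lfree); rewrite /= -hq.
  have hE be : c * ((k * mu + be * (kap * kO)) ^+ 2 * k - ((k * lam) ^+ 3 +
      a * (k * lam * k ^+ 2) + b * k ^+ 3)) = d * ((be * wedge p s) ^+ 2 * wedge s p).
    have := line_section_eval hl (p + be *: s).
    rewrite fE !mulmxDl -!scalemxAl -hp -hs Skap -!scalemxAl PM OM !scaled_point.
    rewrite addr_point !pointE qp !wedgeDr !wedgeZr !wedgepp !(mulr0, add0r, addr0, mulr1).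
    by move=> e; apply: (etrans _ (etrans e _)); ring.
  (* The right side of [hE] is even in [be]; the odd part of the left side is a nonzero multiple of
     [mu]. *)
  apply/eqP; have : c * (4 * k ^+ 2 * (kap * kO)) * mu = 0.
    transitivity (d * ((1 * wedge p s) ^+ 2 * wedge s p)
      - d * ((-1 * wedge p s) ^+ 2 * wedge s p)); last by ring.
    by rewrite -!hE; ring.
  move/eqP; rewrite (natrM K 2 2) !mulf_eq0 (negPf c0) (negPf two_neq0).
  by rewrite (negPf k0) (negPf kap0) (negPf kO0).
move=> mu0; exists O; case: hO => hO hOOO; split=> //.
pose l : 'M[K]_(2, 3) := col_mx P O.
have lE t : t *m l = t 0 0 *: P + t 0 1 *: O.
  rewrite mulmx_sum_row !big_ord_recl big_ord0 addr0; congr (_ *: _ + _ *: _).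
  - apply/rowP=> j; rewrite !mxE; case: splitP => // -[[]] // hj _.
    by congr (P _ _); apply: val_inj.
  - by congr (t _ _); apply: val_inj.
  - apply/rowP=> j; rewrite !mxE; case: splitP => [[[]]|[[]]] // hj _.
    by congr (O _ _); apply: val_inj.
have lM t : t *m l *m M = point (t 0 0 * (k * lam)) (t 0 1 * kO) (t 0 0 * k).
  rewrite lE mulmxDl -!scalemxAl PM OM !scaled_point addr_point mu0.
  by congr point; ring.
have lfree : row_free l.
  rewrite -kermx_eq0; apply/rowV0P => t /sub_kermxP tl.
  have := lM t; rewrite tl mul0mx => /rowP e.
  have := e i1; have := e i2; rewrite !mxE /= => /esym/eqP + /esym/eqP.
  rewrite !mulf_eq0 (negPf k0) (negPf kO0) !orbF => /eqP t0 /eqP t1.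
  apply/rowP=> -[[|[|//]] h]; rewrite mxE.
    by rewrite -[RHS]t0; congr (t _ _); apply: val_inj.
  by rewrite -[RHS]t1; congr (t _ _); apply: val_inj.
pose p : 'rV[K]_2 := delta_mx 0 0; pose s : 'rV[K]_2 := delta_mx 0 1.
have pl : P = p *m l by rewrite lE !mxE /= scale1r scale0r addr0.
have sl : O = s *m l by rewrite lE !mxE /= scale1r scale0r add0r.
(* On this line the cubic is [c * kO^2 * k * t0 * t1^2], while [wedge p t = t1] and
   [wedge s t = - t0]; hence the sign of the constant. *)
rewrite {1 2}pl {1}sl; apply: (line_sectionI (c := - (c * kO ^+ 2 * k))) => //.
  by rewrite oppr_eq0 !mulf_neq0 ?expf_neq0.
move=> t; rewrite fE lM !pointE /wedge !mxE /=.
have muE0 : b = - (lam ^+ 3 + a * lam).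
  by apply/eqP; rewrite eq_sym -subr_eq0 -opprD oppr_eq0 -muE mu0 expr0n.
by rewrite muE0; ring.
Qed.

End Weierstrass.

(** * The tensors of the model groups *)

Section Model.
Variable K : fieldType.
Implicit Types (a lam mu : K) (u v : 'cV[K]_3).

Definition J_coef a lam mu (i : 'I_3) : 'M[K]_3 := seq_mx 3 3
  (nth [::] [:: [:: [:: 1; 0; 0]; [:: 0; lam; 1]; [:: 0; 1; 0]];
                [:: [:: 0; 1; 0]; [:: 1; 0; 0]; [:: 0; 0; 0]];
                [:: [:: - lam; - mu; 0]; [:: mu; a + lam ^+ 2; 0]; [:: 0; 0; -1]]] i).

Definition J_pair a lam mu u v : 'rV[K]_3 :=
  \row_i (u^T *m J_coef a lam mu i *m v) 0 0.

Lemma J_pairE a lam mu u v : J_pair a lam mu u v = point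
  (u i0 0 * v i0 0 + lam * u i1 0 * v i1 0 + u i1 0 * v i2 0 + u i2 0 * v i1 0)
  (u i0 0 * v i1 0 + u i1 0 * v i0 0)
  (- lam * u i0 0 * v i0 0 - mu * u i0 0 * v i1 0 + mu * u i1 0 * v i0 0
     + (a + lam ^+ 2) * u i1 0 * v i1 0 - u i2 0 * v i2 0).
Proof.
apply/rowP; apply: ord3P; rewrite !mxE sum_ord3 !mxE !sum_ord3 !mxE /=; ring.
Qed.

Lemma coef_B_EP a lam mu i : coef_mx (B_EP a lam mu) i =
  block_mx 0 (J_coef a lam mu i) (- (J_coef a lam mu i)^T) 0 :> 'M_(3 + 3).
Proof.
have JE j k : (J_EP a lam mu j k)@_U_(i) = J_coef a lam mu i j k.
  rewrite !mxE; move: i j k.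
  do 3! apply: ord3P; rewrite /= ?(mcoeffD, mcoeffB, mcoeffN, mcoeffZ, mcoeffX, mcoeff0);
   rewrite ?eq_mnm1 /=; ring.
rewrite /B_EP; move: (J_EP _ _ _) (J_coef _ _ _ _) JE => J J' JE.
apply/matrixP=> j k; rewrite mxE !mxE.
by case: splitP => j' _; rewrite !mxE; case: splitP => k' _;
  rewrite ?mxE ?mcoeff0 ?mcoeffN ?JE.
Qed.

Lemma tensor_B_EP a lam mu (u v : 'cV[K]_(3 + 3)) :
  tensor (B_EP a lam mu) u v =
  J_pair a lam mu (usubmx u) (dsubmx v) - J_pair a lam mu (usubmx v) (dsubmx u).
Proof.
apply/rowP=> i; rewrite tensorE; set J := J_coef a lam mu i.
transitivity ((u^T *m block_mx 0 J (- J^T) 0 *m v) 0 0).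
  by rewrite coef_B_EP.
rewrite -{1}[u]vsubmxK -{1}[v]vsubmxK tr_col_mx mul_row_block !mulmx0 add0r addr0.
rewrite mul_row_col mxE addrC [RHS]mxE [X in _ = _ + X]mxE; congr (_ + _).
  by rewrite [RHS]mxE.
rewrite mulmxN mulNmx mxE; congr (- _); rewrite [RHS]mxE.
have tr11 (C : 'M[K]_1) : C 0 0 = C^T 0 0 by rewrite mxE.
by rewrite tr11 !trmx_mul !trmxK mulmxA.
Qed.

(** Evaluating at standard basis vectors expresses the coordinates of [X u] through finitely many
    values of [Y], and conversely, so linearity comes out of the equations. The second parameter
    [mu'] serves the off-diagonal blocks of an adjoint pair, where [mu' = - mu]. *)
Lemma J_pair_adjoint a lam mu mu' (X Y : 'cV[K]_3 -> 'cV[K]_3) :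
  (forall u v, J_pair a lam mu (X u) v = J_pair a lam mu' u (Y v)) ->
  exists x, [/\ forall u, X u = x *: u, forall v, Y v = x *: v & mu * x = mu' * x].
Proof.
move=> h.
pose e i : 'cV[K]_3 := delta_mx i 0.
have eE i j : e i j 0 = (j == i)%:R by rewrite mxE andbT.
have h0 u v := congr1 (fun w : 'rV_3 => w 0 i0) (h u v).
have h1 u v := congr1 (fun w : 'rV_3 => w 0 i1) (h u v).
have h2 u v := congr1 (fun w : 'rV_3 => w 0 i2) (h u v).
pose simp := (eE, mulr0, mul0r, addr0, add0r, mulr1, mul1r, oppr0, subr0, sub0r).
have X0 u : X u i0 0 = u i0 0 * Y (e i1) i1 0 + u i1 0 * Y (e i1) i0 0.
  by have := h1 u (e i1); rewrite !J_pairE !pointE !simp.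
have X1 u : X u i1 0 = u i0 0 * Y (e i0) i1 0 + u i1 0 * Y (e i0) i0 0.
  by have := h1 u (e i0); rewrite !J_pairE !pointE !simp.
have [Y02 Y12] : Y (e i2) i0 0 = 0 /\ Y (e i2) i1 0 = 0.
  by split; [have := h1 (e i1) (e i2) | have := h1 (e i0) (e i2)];
    rewrite !J_pairE !pointE !simp.
have X1' u : X u i1 0 = u i1 0 * Y (e i2) i2 0.
  by have := h0 u (e i2); rewrite !J_pairE !pointE Y02 Y12 !simp.
set x := Y (e i2) i2 0 in X1'.
have Y10 : Y (e i0) i1 0 = 0 by have := X1 (e i0); rewrite X1' !simp.
have Y00 : Y (e i0) i0 0 = x by have := X1 (e i1); rewrite X1' !simp.
have X0' u : X u i0 0 = u i0 0 * x + u i1 0 * Y (e i0) i2 0.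
  by have := h0 u (e i0); rewrite !J_pairE !pointE Y10 Y00 !simp.
have Y11 : Y (e i1) i1 0 = x by have := X0 (e i0); rewrite X0' !simp.
have X2 u : X u i2 0 = u i2 0 * x.
  have := h2 u (e i2); rewrite !J_pairE !pointE Y02 Y12 !simp.
  by move/oppr_inj.
have Y01 : Y (e i1) i0 0 = 0.
  by have := h0 (e i0) (e i1); rewrite !J_pairE !pointE X1' X2 !simp.
have XE u : X u = x *: u.
  apply/colP; apply: ord3P; rewrite mxE mulrC.
  - by rewrite X0 Y01 Y11 mulr0 addr0.
  - exact: X1'.
  - exact: X2.
exists x; split=> // [v|].
  have Yv0 : x * v i0 0 = Y v i0 0.
    by have := h1 (e i1) v; rewrite !J_pairE !pointE XE !mxE /= !simp.
  have Yv1 : x * v i1 0 = Y v i1 0.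
    by have := h1 (e i0) v; rewrite !J_pairE !pointE XE !mxE /= !simp.
  apply/colP; apply: ord3P; rewrite mxE //.
  have := h0 (e i1) v; rewrite !J_pairE !pointE XE !mxE /= !simp -Yv1.
  by rewrite -!mulrA => /addrI.
have := h2 (e i0) (e i1).
rewrite !J_pairE !pointE XE !mxE /= Y11 Y01 !simp.
by move/oppr_inj.
Qed.
Lemma J_pairN a lam mu u v : J_pair a lam mu u (- v) = - J_pair a lam mu u v.
Proof. by rewrite !J_pairE; apply/rowP; apply: ord3P; rewrite !mxE /=; ring. Qed.

Lemma J_pair0l a lam mu v : J_pair a lam mu 0 v = 0.
Proof. by rewrite !J_pairE; apply/rowP; apply: ord3P; rewrite !mxE /=; ring. Qed.

Lemma J_pair0r a lam mu u : J_pair a lam mu u 0 = 0.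
Proof. by rewrite !J_pairE; apply/rowP; apply: ord3P; rewrite !mxE /=; ring. Qed.

(** Transposing [J_EP] replaces the point P by -P. *)
Lemma J_pairC a lam mu u v : J_pair a lam mu u v = J_pair a lam (- mu) v u.
Proof. by rewrite !J_pairE; congr point; ring. Qed.

(** Restricted to the isotropic summands [l] and [r], each of the four blocks is an instance of
    [J_pair_adjoint]. For the off-diagonal blocks both arguments lie in the same summand, and
    [J_pairC] brings in [- mu]. *)
Lemma B_EP_adjoint a lam mu (f g : 'cV[K]_(3 + 3) -> 'cV[K]_(3 + 3)) :
  {morph f : u v / u + v} -> {morph g : u v / u + v} ->
  (forall u v : 'cV_(3 + 3),
     tensor (B_EP a lam mu) (f u) v = tensor (B_EP a lam mu) u (g v)) ->
  exists x y z w, [/\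
    forall u : 'cV_(3 + 3), f u =
      col_mx (x *: usubmx u + w *: dsubmx u) (z *: usubmx u + y *: dsubmx u),
    forall u : 'cV_(3 + 3), g u =
      col_mx (y *: usubmx u - w *: dsubmx u) (- z *: usubmx u + x *: dsubmx u),
    mu * w = - mu * w & mu * z = - mu * z].
Proof.
move=> fD gD h.
have {}h (u v : 'cV_(3 + 3)) : J_pair a lam mu (usubmx (f u)) (dsubmx v)
      - J_pair a lam mu (usubmx v) (dsubmx (f u)) =
    J_pair a lam mu (usubmx u) (dsubmx (g v))
      - J_pair a lam mu (usubmx (g v)) (dsubmx u).
  by rewrite -!tensor_B_EP h.
pose l (p : 'cV[K]_3) : 'cV[K]_(3 + 3) := col_mx p 0.
pose r (p : 'cV[K]_3) : 'cV[K]_(3 + 3) := col_mx 0 p.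
have simp := (col_mxKu, col_mxKd, J_pair0l, J_pair0r, subr0, sub0r).
have [x [fx gx _]] : exists x, [/\ forall p, usubmx (f (l p)) = x *: p,
    forall q, dsubmx (g (r q)) = x *: q & mu * x = mu * x].
  apply: (@J_pair_adjoint a lam) => p q.
  by have := h (l p) (r q); rewrite !simp.
have [y [gy fy _]] : exists y, [/\ forall p, usubmx (g (l p)) = y *: p,
    forall q, dsubmx (f (r q)) = y *: q & mu * y = mu * y].
  apply: (@J_pair_adjoint a lam) => p q.
  by have := h (r q) (l p); rewrite !simp => /oppr_inj.
have [w [fw gw hw]] : exists w, [/\ forall p, usubmx (f (r p)) = w *: p,
    forall q, - usubmx (g (r q)) = w *: q & mu * w = - mu * w].
  apply: (@J_pair_adjoint a lam) => p q.
  by have := h (r p) (r q); rewrite !simp J_pairN -J_pairC.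
have [z [fz gz hz]] : exists z, [/\ forall p, dsubmx (f (l p)) = z *: p,
    forall q, - dsubmx (g (l q)) = z *: q & - mu * z = mu * z].
  apply: (@J_pair_adjoint a lam) => p q.
  by have := h (l p) (l q); rewrite !simp J_pairN -J_pairC => <-; rewrite opprK.
have lr (u : 'cV_(3 + 3)) : u = l (usubmx u) + r (dsubmx u).
  by rewrite /l /r add_col_mx addr0 add0r vsubmxK.
exists x, y, z, w; split=> // u; rewrite {1}[u]lr.
  by rewrite fD -[f (l _)]vsubmxK -[f (r _)]vsubmxK add_col_mx fx fw fz fy.
rewrite gD -[g (l _)]vsubmxK -[g (r _)]vsubmxK add_col_mx gx gy.
by rewrite -[usubmx (g (r _))]opprK -[dsubmx (g (l _))]opprK gw gz scaleNr.
Qed.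

Lemma B_EP_adjointI a lam mu (x y z w : K) (u v : 'cV[K]_(3 + 3)) :
  mu * w = 0 -> mu * z = 0 ->
  tensor (B_EP a lam mu)
    (col_mx (x *: usubmx u + w *: dsubmx u) (z *: usubmx u + y *: dsubmx u)) v =
  tensor (B_EP a lam mu) u
    (col_mx (y *: usubmx v - w *: dsubmx v) (- z *: usubmx v + x *: dsubmx v)).
Proof.
move=> hw hz; have hmu : mu = 0 \/ w = 0 /\ z = 0.
  have [->|mu0] := eqVneq mu 0; [by left | right].
  by split; apply: (mulfI mu0); rewrite mulr0.
rewrite !tensor_B_EP !col_mxKu !col_mxKd !J_pairE.
by case: hmu => [->|[-> ->]]; apply/rowP; apply: ord3P; rewrite !mxE /=; ring.
Qed.

End Model.

(** * Isomorphisms of Baer groups *)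

Section Groups.
Variable K : fieldType.
Implicit Types B : 'M[{mpoly K[3]}]_6.

Lemma tensor_skew B u v : B^T = - B -> tensor B v u = - tensor B u v.
Proof.
move=> hB; apply/rowP=> i; rewrite [RHS]mxE !tensorE.
have hC : (coef_mx B i)^T = - coef_mx B i.
  by apply/matrixP=> j k; have /matrixP/(_ j k) := hB;
    rewrite !mxE => ->; rewrite mcoeffN.
have tr11 (C : 'M[K]_1) : C 0 0 = C^T 0 0 by rewrite mxE.
by rewrite tr11 !trmx_mul trmxK hC mulNmx mulmxN mulmxA mxE.
Qed.

Definition nondegenerate B := forall u, (forall v, tensor B u v = 0) -> u = 0.

Lemma pseudo_isometry_group_iso B B' (P : 'M[K]_6) (R : 'M[K]_3) :
  P \in unitmx -> R \in unitmx ->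
  (forall u v, tensor B' (P *m u) (P *m v) = tensor B u v *m R) ->
  group_iso (baer B) (baer B').
Proof.
move=> Punit Runit h.
pose f (g : baer B) : baer B' := (P *m g.1, g.2 *m R).
have fM : {morph f : x y / (x * y)%g}.
  case=> [u x] [v y]; congr pair; rewrite /= ?mulmxDr // !mulmxDl h.
  by rewrite -scalemxAl.
pose F : {multiplicative baer B -> baer B'} :=
  HB.pack f (isMultiplicative.Build (baer B) (baer B') f fM).
exists F; exists (fun g => (invmx P *m g.1, g.2 *m invmx R)).
  by case=> u x; rewrite /= /f /= mulKmx // mulmxK.
by case=> u x; rewrite /= /f /= mulKVmx // mulmxKV.
Qed.

Hypothesis two_neq0 : 2 != 0 :> K.

Lemma baer_commute B (g h : baer B) : B^T = - B ->
  commute g h <-> tensor B g.1 h.1 = 0.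
Proof.
move=> hB; case: g h => [u x] [v y]; rewrite /commute.
have half0 (w : 'rV[K]_3) : 2^-1 *: w = 2^-1 *: - w -> w = 0.
  move/(scalerI (invr_neq0 two_neq0))/eqP; rewrite -addr_eq0 -mulr2n -scaler_nat.
  by rewrite scaler_eq0 (negPf two_neq0) => /eqP.
split=> [[_]|/= uv].
  by rewrite (tensor_skew u v hB) [y + x]addrC => /addrI/half0.
congr pair; rewrite /= [LHS]addrC // [y + x]addrC (tensor_skew u v hB) uv oppr0.
by rewrite addrC.
Qed.

Section Isomorphism.
Variables (B B' : 'M[{mpoly K[3]}]_6).
Hypotheses (hB : B^T = - B) (hB' : B'^T = - B') (ndB' : nondegenerate B').
Variables (F : {multiplicative baer B -> baer B'}) (G : baer B' -> baer B).
Hypothesis (GK : cancel G F).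

(** [(0, w)] is central and [F] is surjective, so the image is central; nondegeneracy then kills its
    first component. *)
Lemma baer_iso_central w : (F (0, w)).1 = 0.
Proof.
apply: ndB' => v; apply/(baer_commute (F (0, w)) (v, 0) hB').
rewrite -[X in commute _ X]GK; apply: gmulf_commute.
by apply/baer_commute; rewrite //= tensor0l.
Qed.

Lemma baer_iso_fst g : (F g).1 = (F (g.1, 0)).1.
Proof.
case: g => v w; have {1}-> : ((v, w) : baer B) = (((v, 0) : baer B) * (0, w))%g :> baer B.
  by congr pair; rewrite /= ?addr0 // tensor0r scaler0 add0r addr0.
by rewrite gmulfM /= baer_iso_central addr0.
Qed.

Lemma baer_iso_fstD u v : (F (u + v, 0)).1 = (F (u, 0)).1 + (F (v, 0)).1.
Proof.
transitivity (F (((u, 0) : baer B) * (v, 0))%g).1; last by rewrite gmulfM.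
by rewrite [RHS]baer_iso_fst.
Qed.

(** The tensor is the commutator pairing: apply [F] to (u, 0)(v, 0) = (0, t(u, v))(v, 0)(u, 0). *)
Lemma baer_iso_tensor u v : tensor B' (F (u, 0)).1 (F (v, 0)).1 = (F (0, tensor B u v)).2.
Proof.
have half2 (w : 'rV[K]_3) : 2^-1 *: w + 2^-1 *: w = w.
  by rewrite -scalerDr -mulr2n -scaler_nat scalerA mulVf // scale1r.
have e : (((u, 0) : baer B) * (v, 0) =
    ((0, tensor B u v) : baer B) * (((v, 0) : baer B) * (u, 0)))%g.
  congr pair => /=; first by rewrite add0r addrC.
  rewrite tensor0l scaler0 !addr0 !add0r (tensor_skew u v hB) scalerN.
  by rewrite -{2}[tensor B u v]half2 addrK.
have := congr1 F e; rewrite !gmulfM => /(congr1 snd) /=.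
rewrite baer_iso_central tensor0l scaler0 addr0 [(F (v, 0)).2 + _]addrC.
rewrite -!addrA [RHS]addrCA => /addrI; rewrite [RHS]addrCA => /addrI.
rewrite (tensor_skew _ (F (v, 0)).1 hB') scalerN => /eqP.
by rewrite -subr_eq opprK half2 => /eqP.
Qed.

End Isomorphism.

Lemma group_iso_pseudo_isometry B B' : B^T = - B -> B'^T = - B' ->
  nondegenerate B -> nondegenerate B' -> group_iso (baer B) (baer B') ->
  exists (f g : 'cV[K]_6 -> 'cV[K]_6) (h : 'rV[K]_3 -> 'rV[K]_3),
    [/\ {morph f : u v / u + v}, cancel f g, cancel g f, injective h
      & forall u v, tensor B' (f u) (f v) = h (tensor B u v)].
Proof.
move=> hB hB' ndB ndB' [F [G FK GK]].
pose G' : {multiplicative baer B' -> baer B} :=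
  HB.pack G (isMultiplicative.Build (baer B') (baer B) G (can2_gmulfM FK GK)).
(* [f] and [g] are induced on the quotients by the elements [(0, w)], and [h] is the restriction to
   these elements. *)
exists (fun u => (F (u, 0)).1), (fun u => (G (u, 0)).1), (fun w => (F (0, w)).2).
split.
- exact: (baer_iso_fstD hB hB' ndB' GK).
- by move=> u; have := @baer_iso_fst _ _ hB' hB ndB G' F FK (F (u, 0)); rewrite /= FK => <-.
- by move=> u; have := @baer_iso_fst _ _ hB hB' ndB' F G GK (G (u, 0)); rewrite /= GK => <-.
- move=> w w' e.
  have E x : F (0, x) = (0, (F (0, x)).2).
    by case: (F (0, x)) (baer_iso_central hB hB' ndB' GK x) => c d /= ->.
  by have /(can_inj FK)[] : F (0, w) = F (0, w') by rewrite E e -E.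
- exact: (baer_iso_tensor hB hB' ndB' GK).
Qed.

End Groups.

(** * Semilinearity of isomorphisms onto the model groups *)

Section Semilinear.
Variable K : fieldType.
Implicit Types (a lam mu : K) (B : 'M[{mpoly K[3]}]_6).

Lemma B_EP_skew a lam mu : (B_EP a lam mu)^T = - B_EP a lam mu.
Proof.
apply: etrans (tr_block_mx (0 : 'M_3) _ _ (0 : 'M_3)) _.
apply: etrans (esym (opp_block_mx (0 : 'M_3) _ _ (0 : 'M_3))).
by rewrite !trmx0 !oppr0 linearN /= trmxK opprK.
Qed.

Lemma B_EP_nondegenerate a lam mu : nondegenerate (B_EP a lam mu).
Proof.
suff nd nu (p : 'cV[K]_3) : (forall q, J_pair a lam nu p q = 0) -> p = 0.
  move=> u; rewrite -[u](@vsubmxK _ 3 3) => h.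
  rewrite (nd mu (usubmx (u : 'cV_(3 + 3)))) => [|q].
    rewrite (nd (- mu) (dsubmx (u : 'cV_(3 + 3)))) ?col_mx0 // => q.
    have := h (col_mx q 0 : 'cV_(3 + 3)); rewrite tensor_B_EP !col_mxKu !col_mxKd.
    by rewrite J_pair0r sub0r -J_pairC => /eqP; rewrite oppr_eq0 => /eqP.
  have := h (col_mx 0 q : 'cV_(3 + 3)); rewrite tensor_B_EP !col_mxKu !col_mxKd.
  by rewrite J_pair0l subr0.
move=> h; have e q := congr1 (fun w : 'rV_3 => (w 0 i0, w 0 i1)) (h q).
have p1 : p i1 0 = 0.
  have := e (delta_mx i2 0); rewrite J_pairE !pointE !mxE /= => -[].
  by rewrite !(mulr0, add0r, addr0, mulr1).
have p0 : p i0 0 = 0.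
  have := e (delta_mx i1 0); rewrite J_pairE !pointE !mxE /= => -[_].
  by rewrite !(mulr0, add0r, addr0, mulr1).
have p2 : p i2 0 = 0.
  have := e (delta_mx i1 0); rewrite J_pairE !pointE !mxE /= => -[+ _].
  by rewrite p1 !(mulr0, mul0r, add0r, addr0, mulr1).
by apply/colP; apply: ord3P; rewrite mxE.
Qed.

Hypothesis two_neq0 : 2 != 0 :> K.

Lemma eq_oppr0 (x : K) : x = - x -> x = 0.
Proof.
move/eqP; rewrite -addr_eq0 -mulr2n -mulr_natl mulf_eq0 (negPf two_neq0).
by move/eqP.
Qed.

Lemma J_pair_map (s : {rmorphism K -> K}) a lam mu u v :
  J_pair (s a) (s lam) (s mu) (map_mx s u) (map_mx s v) =
  map_mx s (J_pair a lam mu u v).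
Proof.
rewrite !J_pairE; apply/rowP; apply: ord3P; rewrite !mxE /=;
by rewrite !(rmorphD, rmorphB, rmorphN, rmorphM, rmorphXn).
Qed.

(* Additive maps need not be [K]-linear; the new parameters are the preimages of
   the old ones under the field automorphism with respect to which the given
   isomorphism is semilinear. *)
Lemma group_iso_B_EP B a lam mu : B^T = - B -> nondegenerate B ->
  group_iso (baer B) (baer (B_EP a lam mu)) ->
  exists (Q : 'M[K]_6) (a' lam' mu' : K), [/\ Q \in unitmx, mu' = 0 <-> mu = 0
    & forall u v x y, tensor B u v = tensor B x y <->
      tensor (B_EP a' lam' mu') (Q *m u) (Q *m v) =
      tensor (B_EP a' lam' mu') (Q *m x) (Q *m y)].
Proof.
move=> hB ndB /(group_iso_pseudo_isometry two_neq0 hB (B_EP_skew _ _ _) ndB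
  (@B_EP_nondegenerate _ _ _)) [f [g [h [fD fK gK hinj ft]]]].
have gD : {morph g : u v / u + v}.
  by move=> u v; apply: (can_inj fK); rewrite gK fD !gK.
have tZl k (C : 'M[{mpoly K[3]}]_6) u v : tensor C (k *: u) v = k *: tensor C u v.
  by apply/rowP=> i; rewrite [RHS]mxE !tensorE linearZ /= -!scalemxAl mxE.
have tZr k (C : 'M[{mpoly K[3]}]_6) u v : tensor C u (k *: v) = k *: tensor C u v.
  by apply/rowP=> i; rewrite [RHS]mxE !tensorE -!scalemxAr mxE.
(* Scalars are self-adjoint for [tensor B], so their conjugates by [f] are self-adjoint for the
   model. Equating the two shapes in [B_EP_adjoint] gives [x = y], [w = - w], [z = - z], hence a
   scalar. *)
have scal k : exists x, forall u, f (k *: g u) = x *: u.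
  pose X (u : 'cV[K]_(3 + 3)) : 'cV[K]_(3 + 3) := f (k *: g u).
  have XD : {morph X : u v / u + v} by move=> u v; rewrite /X gD scalerDr fD.
  have [|x [y [z [w [X1 X2 _ _]]]]] := @B_EP_adjoint _ a lam mu X X XD XD.
    by move=> u v; rewrite -{1}[v]gK -{2}[u]gK /X !ft tZl tZr.
  have e (u : 'cV_(3 + 3)) :
      col_mx (x *: usubmx u + w *: dsubmx u) (z *: usubmx u + y *: dsubmx u) =
      col_mx (y *: usubmx u - w *: dsubmx u) (- z *: usubmx u + x *: dsubmx u).
    by rewrite -X1 -X2.
  pose entries (v : 'cV[K]_(3 + 3)) := (usubmx v 0 0, dsubmx v 0 0).
  have e1 := congr1 entries (e (col_mx (delta_mx 0 0) 0)).
  have e2 := congr1 entries (e (col_mx 0 (delta_mx 0 0))).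
  move: e1 e2; rewrite /entries !col_mxKu !col_mxKd !mxE /=.
  rewrite !(mulr0, mulr1, add0r, addr0, subr0).
  case=> xy /eq_oppr0 z0 [/eq_oppr0 w0 _]; exists x => u.
  rewrite [LHS]X1 w0 z0 -xy !scale0r addr0 add0r.
  by rewrite -scale_col_mx vsubmxK.
pose s (k : K) : K := (f (k *: g (delta_mx 0 0))) 0 0.
have sg k u : f (k *: g u) = s k *: u.
  by have [x xE] := scal k; rewrite /s !xE !mxE mulr1.
have sf k u : f (k *: u) = s k *: f u by rewrite -{1}[u]fK sg.
have sD : {morph s : x y / x + y}.
  by move=> x y; rewrite /s scalerDl fD mxE.
have s1 : s 1 = 1 by rewrite /s scale1r gK mxE.
have sM : {morph s : x y / x * y}.
  by move=> x y; rewrite {1}/s -scalerA sf mxE sf mxE gK mxE mulr1.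
have sB : {morph s : x y / x - y}.
  move=> x y; apply: (addIr (s y)); rewrite -sD !subrK //.
pose S : {rmorphism K -> K} := HB.pack s
  (GRing.isZmodMorphism.Build K K s sB)
  (GRing.isMonoidMorphism.Build K K s (s1, sM)).
have f0 : f 0 = 0 by apply: (addIr (f 0)); rewrite -fD !add0r.
pose Q : 'M[K]_6 := \matrix_(i, j) f (delta_mx j 0) i 0.
have fE u : f u = Q *m map_mx S u.
  have uE : u = \sum_i u i 0 *: delta_mx i 0.
    by rewrite {1}[u]matrix_sum_delta; apply: eq_bigr => i _; rewrite big_ord1.
  rewrite {1}uE (big_morph f fD f0); apply/colP=> i; rewrite summxE mxE.
  by apply: eq_bigr => j _; rewrite sf !mxE mulrC.
have Qunit : Q \in unitmx.
  apply: (proj1 (@mulmx1_unit _ _ Q (\matrix_(i, j) S (g (delta_mx j 0) i 0)) _)).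
  apply/matrixP=> i j; rewrite mxE.
  have := gK (delta_mx j 0); rewrite fE => /colP/(_ i); rewrite !mxE andbT => <-.
  by apply: eq_bigr => l _; rewrite !mxE.
(* Surjectivity of [f] gives that of [S]: the preimage of [Q *m const_mx k] has entries that [S]
   sends to [k]. *)
have S_surj k : exists k', S k' = k.
  exists ((g (Q *m const_mx k)) 0 0).
  have := gK (Q *m const_mx k); rewrite fE => /(can_inj (mulKmx Qunit)) /colP/(_ 0).
  by rewrite !mxE.
have [Q' Q'E] : exists Q', map_mx S Q' = Q.
  have /fin_all_exists[q qE] (ij : 'I_6 * 'I_6) := S_surj (Q ij.1 ij.2).
  by exists (\matrix_(i, j) q (i, j)); apply/matrixP=> i j; rewrite !mxE (qE (i, j)) mxE.
have [a' aE] := S_surj a; have [lam' lamE] := S_surj lam; have [mu' muE] := S_surj mu.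
(* Pulling [Q], [a], [lam] and [mu] back along [S] moves the semilinearity from the arguments to the
   values of the tensor. *)
have tE u v : map_mx S (tensor (B_EP a' lam' mu') (Q' *m u) (Q' *m v)) = h (tensor B u v).
  rewrite -ft !fE -Q'E -!map_mxM -aE -lamE -muE.
  rewrite !(@tensor_B_EP _ _ _ _ (_ : 'cV_(3 + 3)) (_ : 'cV_(3 + 3))).
  rewrite -!map_usubmx -!map_dsubmx !J_pair_map.
  by apply/rowP=> i; rewrite !mxE rmorphB.
exists Q', a', lam', mu'; split.
- by rewrite -(map_unitmx S) Q'E.
- by rewrite -muE; split=> [->|/eqP]; [rewrite rmorph0 | rewrite fmorph_eq0 => /eqP].
(* [S] and [h] are injective, so equalities between tensor values pass in both directions; the
   adjoint condition consists of such equalities. *)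
move=> u v x y; split=> [e|e].
  by apply: (map_mx_inj (f := S)); rewrite !tE e.
by apply: hinj; rewrite -!tE e.
Qed.

End Semilinear.

(** * Adjoint algebras *)

Section AdjointModel.
Variable K : fieldType.
Implicit Types (a lam mu : K) (B : 'M[{mpoly K[3]}]_6) (m : 'M[K]_2).

Lemma sum_ord2_01 (V : nmodType) (F : 'I_2 -> V) : \sum_i F i = F 0 + F 1.
Proof. by rewrite sum_ord2; congr (F _ + F _); apply: val_inj. Qed.

Lemma mx2P (m n : 'M[K]_2) : m 0 0 = n 0 0 -> m 0 1 = n 0 1 -> m 1 0 = n 1 0 ->
  m 1 1 = n 1 1 -> m = n.
Proof.
have ordE (i : 'I_2) : i = 0 \/ i = 1.
  by case: i => [[|[|//]] h]; [left | right]; apply: val_inj.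
by move=> h00 h01 h10 h11; apply/matrixP=> i j;
  case: (ordE i) (ordE j) => -> [] ->.
Qed.

Lemma S2_starE m : [/\ S2_star m 0 0 = m 1 1, S2_star m 0 1 = - m 0 1,
  S2_star m 1 0 = - m 1 0 & S2_star m 1 1 = m 0 0].
Proof.
have -> : S2_star m = - (S2_J K *m m^T *m S2_J K).
  rewrite /S2_star; have JJ : S2_J K *m (- S2_J K) = 1%:M.
    by apply: mx2P; rewrite !mxE sum_ord2_01 !mxE /=; ring.
  suff -> : invmx (S2_J K) = - S2_J K by rewrite mulmxN.
  by rewrite -[LHS]mulmx1 -JJ mulKmx //; case/mulmx1_unit: JJ.
by split; rewrite !mxE sum_ord2_01 !mxE !sum_ord2_01 !mxE /=; ring.
Qed.

(** The Kronecker product of [m] with the identity of size 3. *)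
Definition blow_up m : 'M[K]_6 :=
  block_mx (m 0 0)%:M (m 0 1)%:M (m 1 0)%:M (m 1 1)%:M : 'M_(3 + 3).

Definition blow_down (A : 'M[K]_6) : 'M[K]_2 :=
  (* One entry per block is read; index 3 is the first one of the second summand. *)
  \matrix_(i, j) A (if i == 0 then 0 else inord 3) (if j == 0 then 0 else inord 3).

Lemma blow_upK : cancel blow_up blow_down.
Proof.
have h0 : (0 : 'I_6) = lshift 3 (0 : 'I_3) by apply: val_inj.
have h3 : (inord 3 : 'I_6) = rshift 3 (0 : 'I_3) by apply: val_inj; rewrite /= inordK.
move=> m; apply: mx2P; rewrite mxE /= /blow_up ?h0 ?h3.
- by rewrite (@block_mxEul _ 3 3 3 3) mxE mulr1n.
- by rewrite (@block_mxEur _ 3 3 3 3) mxE mulr1n.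
- by rewrite (@block_mxEdl _ 3 3 3 3) mxE mulr1n.
- by rewrite (@block_mxEdr _ 3 3 3 3) mxE mulr1n.
Qed.

Lemma blow_upM (m n : 'M[K]_2) : blow_up (m *m n) = blow_up m *m blow_up n.
Proof.
rewrite /blow_up; apply: etrans _ (esym (@mulmx_block K 3 3 3 3 3 3 _ _ _ _ _ _ _ _)).
by rewrite !mxE !sum_ord2_01 !raddfD /= !scalar_mxM.
Qed.

Lemma blow_up_mul m (u : 'cV[K]_(3 + 3)) : blow_up m *m u = col_mx
  (m 0 0 *: usubmx u + m 0 1 *: dsubmx u) (m 1 0 *: usubmx u + m 1 1 *: dsubmx u).
Proof.
transitivity (blow_up m *m col_mx (usubmx u) (dsubmx u)); first by rewrite vsubmxK.
apply: etrans (@mul_block_col K 3 3 3 3 1 _ _ _ _ _ _) _.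
by rewrite !mul_scalar_mx.
Qed.

Lemma blow_down_linear : linear blow_down.
Proof. by move=> k A C; apply/matrixP=> i j; rewrite !mxE. Qed.

Lemma mulmx_col_inj (A C : 'M[K]_6) : (forall u : 'cV_6, A *m u = C *m u) -> A = C.
Proof.
by move=> h; apply/matrixP=> i j; have := h (delta_mx j 0);
  rewrite -!colE => /colP/(_ i); rewrite !mxE.
Qed.

(** The shape of the adjoint partner in [B_EP_adjoint] is exactly the symplectic involution
    [S2_star]; as 2 is invertible, its sign conditions say that [mu] kills the off-diagonal
    entries. *)
Lemma B_EP_adjoint_mx a lam mu (A A' : 'M[K]_6) : 2 != 0 :> K ->
  (forall u v, tensor (B_EP a lam mu) (A *m u) v = tensor (B_EP a lam mu) u (A' *m v)) <->
  exists m, [/\ A = blow_up m, A' = blow_up (S2_star m),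
                mu * m 0 1 = 0 & mu * m 1 0 = 0].
Proof.
move=> two_neq0; split=> [h|[m [-> -> h01 h10]] u v]; last first.
  have [s00 s01 s10 s11] := S2_starE m.
  rewrite !(@blow_up_mul _ (_ : 'cV_(3 + 3))) s00 s01 s10 s11 scaleNr.
  exact: B_EP_adjointI.
have [|||x [y [z [w [AE A'E hw hz]]]]] := @B_EP_adjoint _ a lam mu (mulmx A) (mulmx A').
- exact: mulmxDr.
- exact: mulmxDr.
- exact: h.
pose m : 'M[K]_2 := seq_mx 2 2 [:: [:: x; w]; [:: z; y]].
have [s00 s01 s10 s11] := S2_starE m.
exists m; split.
- by apply: mulmx_col_inj => u; rewrite (AE u) (blow_up_mul m u) !mxE.
- apply: mulmx_col_inj => u; rewrite (A'E u) (blow_up_mul (S2_star m) u).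
  by rewrite s00 s01 s10 s11 !mxE !scaleNr.
- by rewrite mxE; apply: (eq_oppr0 two_neq0); rewrite -mulNr.
- by rewrite mxE; apply: (eq_oppr0 two_neq0); rewrite -mulNr.
Qed.

Section Transport.
Variables (B : 'M[{mpoly K[3]}]_6) (hB : B^T = - B) (Q : 'M[K]_6) (a lam mu : K).
Hypotheses (two_neq0 : 2 != 0 :> K) (Qunit : Q \in unitmx).
Hypothesis hQ : forall u v x y, tensor B u v = tensor B x y <->
  tensor (B_EP a lam mu) (Q *m u) (Q *m v) =
  tensor (B_EP a lam mu) (Q *m x) (Q *m y).

Lemma transport_adjoint (x : 'M[K]_6 * ('M[K]_6)^c) : x \in adjoint B <->
  exists m, [/\ Q *m x.1 *m invmx Q = blow_up m,
    Q *m (x.2 : 'M[K]_6) *m invmx Q = blow_up (S2_star m),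
    mu * m 0 1 = 0 & mu * m 1 0 = 0].
Proof.
rewrite -(B_EP_adjoint_mx a lam _ _ _ two_neq0); split=> [/adjointP h u v|h].
  have /hQ := h (invmx Q *m u) (invmx Q *m v).
  by rewrite !mulmxA mulmxV // !mul1mx.
apply/adjointP=> u v; apply/hQ.
by have := h (Q *m u) (Q *m v); rewrite !mulmxA !mulmxKV.
Qed.

Definition adj_mx2 (x : adj B) : 'M[K]_2 := blow_down (Q *m (val x).1 *m invmx Q).

Lemma adj_mx2P (x : adj B) : [/\ Q *m (val x).1 *m invmx Q = blow_up (adj_mx2 x),
    Q *m ((val x).2 : 'M[K]_6) *m invmx Q = blow_up (S2_star (adj_mx2 x)),
    mu * adj_mx2 x 0 1 = 0 & mu * adj_mx2 x 1 0 = 0].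
Proof.
have /transport_adjoint[m [e1 e2 h01 h10]] := valP x.
by rewrite /adj_mx2 e1 blow_upK.
Qed.

Lemma adj_mx2_linear : linear adj_mx2.
Proof.
move=> k x y; rewrite /adj_mx2 -blow_down_linear; congr blow_down.
by rewrite /= mulmxDr mulmxDl -scalemxAr -scalemxAl.
Qed.

Lemma adj_mx2B : {morph adj_mx2 : x y / x - y}.
Proof. by move=> x y; rewrite addrC -scaleN1r adj_mx2_linear scaleN1r addrC. Qed.

Lemma adj_mx2Z : scalable adj_mx2.
Proof.
have rho0 : adj_mx2 0 = 0 by rewrite -[0](subrr 0) adj_mx2B subrr.
by move=> k x; rewrite -[k *: x]addr0 adj_mx2_linear rho0 addr0.
Qed.

Lemma adj_mx2M x y : adj_mx2 (x * y) = adj_mx2 x *m adj_mx2 y.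
Proof.
have [ex _ _ _] := adj_mx2P x; have [ey _ _ _] := adj_mx2P y.
apply: (can_inj blow_upK); rewrite blow_upM -ex -ey.
have [<- _ _ _] := adj_mx2P (x * y).
by rewrite !mulmxA mulmxKV.
Qed.

Lemma adj_mx2_1 : adj_mx2 1 = 1%:M.
Proof.
apply: (can_inj blow_upK); have [<- _ _ _] := adj_mx2P 1.
rewrite mulmx1 mulmxV // /blow_up !mxE /= !raddf0.
exact: (@scalar_mx_block _ 3 3 1).
Qed.

Lemma adj_mx2_star x : adj_mx2 (adj_star hB x) = S2_star (adj_mx2 x).
Proof.
apply: (can_inj blow_upK); have [<- _ _ _] := adj_mx2P (adj_star hB x).
by have [_ <- _ _] := adj_mx2P x.
Qed.

Lemma adj_mx2_inj : injective adj_mx2.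
Proof.
move=> x y e; apply: val_inj.
have [x1 x2 _ _] := adj_mx2P x; have [y1 y2 _ _] := adj_mx2P y.
have canQ (A C : 'M[K]_6) : Q *m A *m invmx Q = Q *m C *m invmx Q -> A = C.
  by move/(can_inj (mulmxKV Qunit))/(can_inj (mulKmx Qunit)).
rewrite [val x]surjective_pairing [val y]surjective_pairing.
by congr pair; apply: canQ; rewrite ?x1 ?x2 ?y1 ?y2 e.
Qed.

(** The boolean equality lets [xchoose] produce an inverse map. *)
Lemma adj_mx2_surj m : mu * m 0 1 = 0 -> mu * m 1 0 = 0 -> exists x, adj_mx2 x == m.
Proof.
move=> h01 h10.
pose z : 'M[K]_6 * ('M[K]_6)^c :=
  (invmx Q *m blow_up m *m Q, invmx Q *m blow_up (S2_star m) *m Q).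
have hz : z \in adjoint B.
  by apply/transport_adjoint; exists m; rewrite /= !mulmxA mulmxV // !mul1mx !mulmxK.
exists (Adj hz); apply/eqP/(can_inj blow_upK); have [<- _ _ _] := adj_mx2P (Adj hz).
by rewrite /= !mulmxA mulmxV // mul1mx mulmxK.
Qed.

Lemma star_iso_S2 : mu = 0 -> star_iso (adj_star hB) (@S2_star K).
Proof.
move=> mu0; pose f : adj B -> S2 K := adj_mx2.
pose F : {lrmorphism adj B -> S2 K} := HB.pack f
  (GRing.isZmodMorphism.Build (adj B) (S2 K) f adj_mx2B)
  (GRing.isMonoidMorphism.Build (adj B) (S2 K) f (adj_mx2_1, adj_mx2M))
  (GRing.isScalable.Build K (adj B) (S2 K) *:%R f adj_mx2Z).
have surj m : exists x, adj_mx2 x == m by apply: adj_mx2_surj; rewrite mu0 mul0r.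
exists F; last exact: adj_mx2_star.
exists (fun m => xchoose (surj m)) => [x|m]; last exact/eqP/(xchooseP (surj m)).
by apply: adj_mx2_inj; apply/eqP/(xchooseP (surj (adj_mx2 x))).
Qed.

(** For [mu] nonzero all the matrices [adj_mx2 x] are diagonal, and [S2_star] exchanges the two
    diagonal entries. *)
Lemma star_iso_X1 : mu != 0 -> star_iso (adj_star hB) (@X1_star K).
Proof.
move=> mu0; pose f (x : adj B) : X1 K := (adj_mx2 x 0 0, adj_mx2 x 1 1).
have [d01 d10] : (forall x, adj_mx2 x 0 1 = 0) /\ (forall x, adj_mx2 x 1 0 = 0).
  by split=> x; have [_ _ h01 h10] := adj_mx2P x; apply: (mulfI mu0); rewrite mulr0.
have fB : {morph f : x y / x - y}.
  by move=> x y; rewrite /f adj_mx2B !mxE.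
have fZ : scalable f.
  by move=> k x; rewrite /f adj_mx2Z !mxE.
have fM : monoid_morphism f.
  split=> [|x y]; first by rewrite /f adj_mx2_1 !mxE.
  have mulE i : (adj_mx2 x *m adj_mx2 y) i i =
      adj_mx2 x i 0 * adj_mx2 y 0 i + adj_mx2 x i 1 * adj_mx2 y 1 i.
    by rewrite mxE sum_ord2_01.
  by rewrite /f adj_mx2M !mulE !d01 !d10 !mul0r addr0 add0r.
pose F : {lrmorphism adj B -> X1 K} := HB.pack f
  (GRing.isZmodMorphism.Build (adj B) (X1 K) f fB)
  (GRing.isMonoidMorphism.Build (adj B) (X1 K) f fM)
  (GRing.isScalable.Build K (adj B) (X1 K) *:%R f fZ).
have finj : injective f.
  by move=> x y [e0 e1]; apply: adj_mx2_inj; apply: mx2P; rewrite ?d01 ?d10.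
have surj p : exists x, f x == p.
  have [||x /eqP xE] := @adj_mx2_surj (seq_mx 2 2 [:: [:: p.1; 0]; [:: 0; p.2]]).
  - by rewrite mxE mulr0.
  - by rewrite mxE mulr0.
  by exists x; rewrite /f xE !mxE; case: p {xE}.
exists F.
  exists (fun p => xchoose (surj p)) => [x|p]; last exact/eqP/(xchooseP (surj p)).
  by apply: finj; apply/eqP/(xchooseP (surj (f x))).
move=> x; rewrite /= /f adj_mx2_star.
by have [-> _ _ ->] := S2_starE (adj_mx2 x).
Qed.

End Transport.

End AdjointModel.

(** * Normal form of 3 x 3 determinantal representations *)

Section NormalForm.
Variable K : fieldType.
Implicit Types (A B C U V : 'M[K]_3).

Lemma det3E (R : comNzRingType) (A : 'M[R]_3) :
  \det A = A i0 i0 * (A i1 i1 * A i2 i2 - A i1 i2 * A i2 i1)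
         - A i0 i1 * (A i1 i0 * A i2 i2 - A i1 i2 * A i2 i0)
         + A i0 i2 * (A i1 i0 * A i2 i1 - A i1 i1 * A i2 i0).
Proof.
have {1}-> : A = seq_mx 3 3 [:: [:: A i0 i0; A i0 i1; A i0 i2];
    [:: A i1 i0; A i1 i1; A i1 i2]; [:: A i2 i0; A i2 i1; A i2 i2]].
  by apply/matrixP; do 2! apply: ord3P; rewrite mxE.
by rewrite det_seq_mx /=; ring.
Qed.

Lemma mx3P (A B : 'M[K]_3) :
  [/\ A i0 i0 = B i0 i0, A i0 i1 = B i0 i1 & A i0 i2 = B i0 i2] ->
  [/\ A i1 i0 = B i1 i0, A i1 i1 = B i1 i1 & A i1 i2 = B i1 i2] ->
  [/\ A i2 i0 = B i2 i0, A i2 i1 = B i2 i1 & A i2 i2 = B i2 i2] -> A = B.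
Proof.
by case=> ? ? ? [? ? ?] [? ? ?]; apply/matrixP; do 2! apply: ord3P.
Qed.

Lemma mulmx33E (U A V : 'M[K]_3) i j : (U *m A *m V) i j =
  (U i i0 * A i0 i0 + U i i1 * A i1 i0 + U i i2 * A i2 i0) * V i0 j +
  (U i i0 * A i0 i1 + U i i1 * A i1 i1 + U i i2 * A i2 i1) * V i1 j +
  (U i i0 * A i0 i2 + U i i1 * A i1 i2 + U i i2 * A i2 i2) * V i2 j.
Proof. by rewrite mxE sum_ord3 !mxE !sum_ord3. Qed.

(** Equivalence of a determinantal representation, given by its coefficient matrices, with [J_EP] at
    some affine point of the curve. *)
Definition normalizable (a b : K) A B C := exists U V lam mu,
  [/\ U \in unitmx, V \in unitmx, mu ^+ 2 = lam ^+ 3 + a * lam + b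
    & [/\ U *m A *m V = J_coef a lam mu i0, U *m B *m V = J_coef a lam mu i1
        & U *m C *m V = J_coef a lam mu i2]].

Lemma normalizable_equiv a b A B C U V : U \in unitmx -> V \in unitmx ->
  normalizable a b (U *m A *m V) (U *m B *m V) (U *m C *m V) ->
  normalizable a b A B C.
Proof.
move=> Uu Vu [U' [V' [lam [mu [Uu' Vu' e [hA hB hC]]]]]].
exists (U' *m U), (V *m V'), lam, mu; split=> //; rewrite ?unitmx_mul ?Uu ?Uu' ?Vu //.
by split; [rewrite -hA|rewrite -hB|rewrite -hC]; rewrite !mulmxA.
Qed.

Definition weierstrass_pencil (c a b : K) A B C := forall x y z,
  \det (x *: A + y *: B + z *: C) =
  c * (y ^+ 2 * z - (x ^+ 3 + a * (x * z ^+ 2) + b * z ^+ 3)).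

Lemma weierstrass_pencil_equiv c a b A B C U V :
  weierstrass_pencil c a b A B C ->
  weierstrass_pencil (\det U * \det V * c) a b (U *m A *m V) (U *m B *m V) (U *m C *m V).
Proof.
move=> h x y z.
transitivity (\det (U *m (x *: A + y *: B + z *: C) *m V)).
  by rewrite !mulmxDr !mulmxDl -!scalemxAr -!scalemxAl.
by rewrite !det_mulmx h; ring.
Qed.

(** The value of [J_EP] at the flex (0 : 1 : 0). *)
Definition swap01_mx : 'M[K]_3 := seq_mx 3 3 [:: [:: 0; 1; 0]; [:: 1; 0; 0]; [:: 0; 0; 0]].

Lemma unitmx_det A : \det A != 0 -> A \in unitmx.
Proof. by rewrite unitmxE unitfE. Qed.

Hypothesis two_neq0 : 2 != 0 :> K.

(** The last rows and columns are already those of [J_EP], and only the upper left 2 x 2 block is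
    left. A shear by [al] clears the off-diagonal entries of that block of [A]; the rest follows by
    comparing coefficients of the determinant. *)
Lemma pencil_normalizable_nilpotent (a b : K) A C :
  weierstrass_pencil 1 a b A swap01_mx C ->
  [/\ A i0 i2 = 0, A i1 i2 = 1, A i2 i0 = 0, A i2 i1 = 1 & A i2 i2 = 0] ->
  [/\ C i0 i2 = 0, C i1 i2 = 0, C i2 i0 = 0, C i2 i1 = 0 & C i2 i2 = -1] ->
  normalizable a b A swap01_mx C.
Proof.
move=> h [A02 A12 A20 A21 A22] [C02 C12 C20 C21 C22].
have hD x y z := etrans (esym (det3E _)) (h x y z).
have {}hD x y z : (x * A i0 i0 + z * C i0 i0) * - ((x * A i1 i1 + z * C i1 i1) * z + x ^+ 2)
   + (x * A i0 i1 + y + z * C i0 i1) * ((x * A i1 i0 + y + z * C i1 i0) * z) =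
   y ^+ 2 * z - (x ^+ 3 + a * (x * z ^+ 2) + b * z ^+ 3).
  rewrite -[RHS]mul1r -hD !mxE /= A02 A12 A20 A21 A22 C02 C12 C20 C21 C22; ring.
(* Combinations of values of [W] at points with coordinates 0, 1, -1 isolate single coefficients,
   computed once from the determinant and once from the cubic. *)
pose W x y z := y ^+ 2 * z - (x ^+ 3 + a * (x * z ^+ 2) + b * z ^+ 3).
have A00 : A i0 i0 = 1.
  by transitivity (- W 1 0 0); [rewrite /W -hD|rewrite /W]; ring.
have two_cancel (u v : K) : 2 * u = 2 * v -> u = v by apply: mulfI.
have A10 : A i1 i0 = - A i0 i1.
  apply: two_cancel.
  transitivity (W 1 1 1 - W 1 (-1) 1 - (W 0 1 1 - W 0 (-1) 1) - 2 * A i0 i1).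
    by rewrite /W -!hD; ring.
  by rewrite /W; ring.
have C10 : C i1 i0 = - C i0 i1.
  apply: two_cancel; transitivity (W 0 1 1 - W 0 (-1) 1 - 2 * C i0 i1).
    by rewrite /W -!hD; ring.
  by rewrite /W; ring.
(* [- lam] and [- mu] are the entries of [C] at (0, 0) and (0, 1) after the shear. *)
pose al := A i0 i1; pose lam := - C i0 i0; pose mu := al * C i0 i0 - C i0 i1.
pose U : 'M[K]_3 := seq_mx 3 3 [:: [:: 1; 0; 0]; [:: al; 1; 0]; [:: 0; 0; 1]].
pose V : 'M[K]_3 := seq_mx 3 3 [:: [:: 1; - al; 0]; [:: 0; 1; 0]; [:: 0; 0; 1]].
pose e := A i1 i1 + al * A i0 i1 - al * (A i1 i0 + al * A i0 i0).
pose f := C i1 i1 + al * C i0 i1 - al * (C i1 i0 + al * C i0 i0).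
have hW x z : W x 0 z = - z * (x - lam * z) * (e * x + f * z) - x ^+ 2 * (x - lam * z)
    - mu ^+ 2 * z ^+ 3.
  by rewrite /W -hD /e /f /lam /mu A10 C10 A00 -/al; ring.
have el : lam = e.
  apply: two_cancel; apply/eqP; rewrite -subr_eq0; apply/eqP.
  transitivity (W 1 0 1 - W 1 0 (-1) - 2 * W 0 0 1); [rewrite !hW|rewrite /W]; ring.
have fE : f = a + lam ^+ 2.
  apply: two_cancel; transitivity (2 * lam * e - 2 - W 1 0 1 - W 1 0 (-1)).
    by rewrite !hW; ring.
  by rewrite -el /W; ring.
have muE : mu ^+ 2 = lam ^+ 3 + a * lam + b.
  transitivity (lam * f - W 0 0 1); first by rewrite hW; ring.
  by rewrite fE /W; ring.
have Uu : U \in unitmx.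
  by apply: unitmx_det; rewrite det3E !mxE /= !(mulr0, mul0r, subr0, addr0, mulr1) oner_eq0.
have Vu : V \in unitmx.
  by apply: unitmx_det; rewrite det3E !mxE /= !(mulr0, mul0r, subr0, addr0, mulr1) oner_eq0.
have eE : A i1 i1 + al * A i0 i1 - al * (A i1 i0 + al * A i0 i0) = lam by [].
exists U, V, lam, mu; split=> //; split.
- apply: mx3P; split; rewrite mulmx33E !mxE /= ?A02 ?A12 ?A20 ?A21 ?A22 ?A10 ?A00;
    rewrite /al; try ring.
  by rewrite -[RHS]eE A10 A00 /al; ring.
- by apply: mx3P; split; rewrite mulmx33E !mxE /=; ring.
- apply: mx3P; split; rewrite mulmx33E !mxE /= ?C02 ?C12 ?C20 ?C21 ?C22 ?C10;
    rewrite /lam /mu; try ring.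
  by rewrite -fE /f C10; ring.
Qed.

(** A base change of the upper 2 x 2 block that fixes [swap01_mx] brings the border of [A] to its
    form in [J_EP]. The vanishing coefficient of [x^2 y] ([qr]) makes one base change work for both
    the row and the column. *)
Lemma pencil_normalizable_border (a b : K) A C :
  weierstrass_pencil 1 a b A swap01_mx C -> A i2 i2 = 0 ->
  [/\ C i0 i2 = 0, C i1 i2 = 0, C i2 i0 = 0, C i2 i1 = 0 & C i2 i2 = -1] ->
  normalizable a b A swap01_mx C.
Proof.
move=> h A22 [C02 C12 C20 C21 C22].
pose p := A i0 i2; pose q := A i1 i2; pose r := A i2 i0; pose s := A i2 i1.
have hD x y z : \det (x *: A + y *: swap01_mx + z *: C) =
    (x * A i0 i0 + z * C i0 i0) * - ((x * A i1 i1 + z * C i1 i1) * z + x ^+ 2 * q * s)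
    - (x * A i0 i1 + y + z * C i0 i1) *
      (- (x * A i1 i0 + y + z * C i1 i0) * z - x ^+ 2 * q * r)
    + x * p * ((x * A i1 i0 + y + z * C i1 i0) * x * s
               - (x * A i1 i1 + z * C i1 i1) * x * r).
  by rewrite det3E !mxE /= A22 C02 C12 C20 C21 C22 -/p -/q -/r -/s; ring.
pose W x y z := 1 * (y ^+ 2 * z - (x ^+ 3 + a * (x * z ^+ 2) + b * z ^+ 3)).
have {}hD x y z := etrans (esym (h x y z)) (hD x y z).
have {}hD x y z : W x y z = _ := hD x y z.
have two_cancel (u v : K) : 2 * u = 2 * v -> u = v by apply: mulfI.
have qr : q * r + p * s = 0.
  apply: two_cancel; transitivity (W 1 1 0 - W 1 (-1) 0); [rewrite !hD|rewrite /W]; ring.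
have A10 : A i1 i0 = - A i0 i1.
  apply: two_cancel.
  transitivity (W 1 1 1 - W 1 (-1) 1 - (W 0 1 1 - W 0 (-1) 1)
    - 2 * (q * r + p * s) - 2 * A i0 i1).
    by rewrite !hD; ring.
  by rewrite qr /W; ring.
(* The 2 x 2 change of basis with inverse [[w1, p], [w2, q]] turns the border
   column (p, q) into (0, 1); w1 and w2 are such that it also turns the border row
   (r, s) into (0, 1), and they exist because [\det A = -1]. *)
pose w1 := q * A i0 i0 - p * A i1 i0; pose w2 := p * A i1 i1 - q * A i0 i1.
have rw : r * w2 + s * w1 = 1.
  transitivity (- W 1 0 0); [rewrite hD /w1 /w2|rewrite /W]; ring.
pose d := w1 * q - w2 * p.
(* If [d] were 0, then [qr] and [rw] would give [p = q = 0], and [rw] would read 0 = 1. *)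
have d0 : d != 0.
  apply/eqP => d0.
  have p0 : p = 0.
    transitivity (p * (r * w2 + s * w1)); first by rewrite rw mulr1.
    transitivity (w1 * (q * r + p * s) - r * d); first by rewrite /d; ring.
    by rewrite qr d0; ring.
  have q0 : q = 0.
    transitivity (q * (r * w2 + s * w1)); first by rewrite rw mulr1.
    transitivity (w2 * (q * r + p * s) + s * d); first by rewrite /d; ring.
    by rewrite qr d0; ring.
  by have /eqP := rw; rewrite /w1 /w2 p0 q0 !(mul0r, subr0, mulr0, addr0) eq_sym oner_eq0.
pose U : 'M[K]_3 := seq_mx 3 3
  [:: [:: q / d; - p / d; 0]; [:: - w2 / d; w1 / d; 0]; [:: 0; 0; 1]].
pose V : 'M[K]_3 := seq_mx 3 3 [:: [:: q; w2; 0]; [:: p; w1; 0]; [:: 0; 0; 1]].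
have dV : \det V = d by rewrite det3E !mxE /= /d; ring.
have dU : \det U = d^-1.
  rewrite det3E !mxE /=; transitivity (d / d ^+ 2); last by field.
  by rewrite /d; field.
have Uu : U \in unitmx by apply: unitmx_det; rewrite dU invr_eq0.
have Vu : V \in unitmx by apply: unitmx_det; rewrite dV.
have dE : d = w1 * q - w2 * p by [].
clearbody d.
have NE : U *m swap01_mx *m V = swap01_mx.
  apply: mx3P; split; rewrite mulmx33E !mxE /=; try ring;
    by rewrite -[RHS](divff d0) [X in _ = X / _]dE; ring.
apply: (normalizable_equiv Uu Vu); rewrite NE; apply: pencil_normalizable_nilpotent.
- have := weierstrass_pencil_equiv U V h.
  by rewrite NE dU dV mulr1 mulVf.
- split; rewrite mulmx33E !mxE /= ?A22 -/p -/q -/r -/s.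
  + by ring.
  + by rewrite -[RHS](divff d0) [X in _ = X / _]dE; ring.
  + by rewrite -[RHS]qr; ring.
  + by rewrite -[RHS]rw; ring.
  + by ring.
- by split; rewrite mulmx33E !mxE /= ?C02 ?C12 ?C20 ?C21 ?C22; ring.
Qed.

(** The [y^2] part of the determinant is [-(x * A22 + z * C22)], so [A22 = 0] and [C22 = - c]. This
    pivot clears the last row and column of [C], without affecting [swap01_mx]. *)
Lemma pencil_normalizable_swap01 (c a b : K) A C : c != 0 ->
  weierstrass_pencil c a b A swap01_mx C ->
  normalizable a b A swap01_mx C.
Proof.
move=> c0 h.
pose W x y z := c * (y ^+ 2 * z - (x ^+ 3 + a * (x * z ^+ 2) + b * z ^+ 3)).
have second_diff x z : W x 1 z + W x (-1) z - 2 * W x 0 z =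
    - 2 * (x * A i2 i2 + z * C i2 i2).
  by rewrite /W -!h !det3E !mxE /=; ring.
have two_cancel (u v : K) : 2 * u = 2 * v -> u = v by apply: mulfI.
have A22 : A i2 i2 = 0.
  apply: two_cancel; transitivity (- (W 1 1 0 + W 1 (-1) 0 - 2 * W 1 0 0)).
    by rewrite second_diff; ring.
  by rewrite /W; ring.
have C22 : C i2 i2 = - c.
  apply: two_cancel; transitivity (- (W 0 1 1 + W 0 (-1) 1 - 2 * W 0 0 1)).
    by rewrite second_diff; ring.
  by rewrite /W; ring.
pose U : 'M[K]_3 := seq_mx 3 3
  [:: [:: 1; 0; C i0 i2 / c]; [:: 0; 1; C i1 i2 / c]; [:: 0; 0; c^-1]].
pose V : 'M[K]_3 := seq_mx 3 3
  [:: [:: 1; 0; 0]; [:: 0; 1; 0]; [:: C i2 i0 / c; C i2 i1 / c; 1]].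
have dU : \det U = c^-1 by rewrite det3E !mxE /=; ring.
have dV : \det V = 1 by rewrite det3E !mxE /=; ring.
have Uu : U \in unitmx by apply: unitmx_det; rewrite dU invr_eq0.
have Vu : V \in unitmx by apply: unitmx_det; rewrite dV oner_eq0.
have NE : U *m swap01_mx *m V = swap01_mx.
  by apply: mx3P; split; rewrite mulmx33E !mxE /=; ring.
apply: (normalizable_equiv Uu Vu); rewrite NE; apply: pencil_normalizable_border.
- by have := weierstrass_pencil_equiv U V h; rewrite NE dU dV mulr1 mulVf.
- by rewrite mulmx33E !mxE /= A22; ring.
- by split; rewrite mulmx33E !mxE /= C22; field.
Qed.

(** [B] is the value of the pencil at the flex. The rank normal form reduces to [pid_mx] of its
    rank, and the cubic forces rank 2. *)
Lemma pencil_normalizable (c a b : K) A B C : c != 0 ->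
  weierstrass_pencil c a b A B C -> normalizable a b A B C.
Proof.
move=> c0 h.
pose L := invmx (col_ebase B); pose R := invmx (row_ebase B).
have Lu : L \in unitmx by rewrite unitmx_inv col_ebase_unit.
have Ru : R \in unitmx by rewrite unitmx_inv row_ebase_unit.
have LBR : L *m B *m R = pid_mx (\rank B).
  rewrite -{1}[B]mulmx_ebase !mulmxA mulVmx ?col_ebase_unit // mul1mx.
  by rewrite mulmxK ?row_ebase_unit.
have rB : (\rank B <= 3)%N := rank_leq_row B.
apply: (normalizable_equiv Lu Ru); have := weierstrass_pencil_equiv L R h.
rewrite LBR; set c' := _ * c => h'.
have c'0 : c' != 0.
  by rewrite /c' !mulf_neq0 // -unitfE -unitmxE.
move: (L *m A *m R) (L *m C *m R) h' => {}A {}C {}h.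
pose W x y z := c' * (y ^+ 2 * z - (x ^+ 3 + a * (x * z ^+ 2) + b * z ^+ 3)).
have W1 : W 0 1 1 + W 0 (-1) 1 - 2 * W 0 0 1 = 2 * c' by rewrite /W; ring.
have W0 : W 0 1 0 = 0 by rewrite /W; ring.
have W1N : 2 * c' != 0 by rewrite mulf_neq0.
case: (\rank B) rB h => [|[|[|[|//]]]] _ h.
(* For rank 0 or 1 the determinant has degree at most 1 in [y], so the second difference [W1], which
   isolates the coefficient of [y^2 z], would vanish. *)
- by move: W1N; rewrite -W1 /W -!h !det3E !mxE /= => /eqP[]; ring.
- by move: W1N; rewrite -W1 /W -!h !det3E !mxE /= => /eqP[]; ring.
- pose S : 'M[K]_3 := seq_mx 3 3 [:: [:: 0; 1; 0]; [:: 1; 0; 0]; [:: 0; 0; 1]].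
  have dS : \det S = -1 by rewrite det3E !mxE /=; ring.
  have Su : S \in unitmx by apply: unitmx_det; rewrite dS oppr_eq0 oner_eq0.
  apply: (normalizable_equiv Su (unitmx1 _ _)).
  have := weierstrass_pencil_equiv S 1%:M h.
  have -> : S *m pid_mx 2 *m 1%:M = swap01_mx.
    by rewrite mulmx1; apply: mx3P; split; rewrite mxE sum_ord3 !mxE /=; ring.
  by rewrite dS det1 => /pencil_normalizable_swap01; apply; rewrite mulr1 mulN1r oppr_eq0.
(* For rank 3 the determinant at (0, 1, 0) would be 1, but the flex lies on the cubic. *)
- have /eqP := W0; rewrite /W -h det3E !mxE /=.
  by rewrite !(mulr0, mulr1, mul0r, addr0, add0r, subr0) oner_eq0.
Qed.

End NormalForm.

(** * Splitting off isotropic subspaces *)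

Section Pencil.
Variable K : fieldType.
Variable B : 'M[{mpoly K[3]}]_6.
Hypotheses (two_neq0 : 2 != 0 :> K) (hlin : forall i j : 'I_6, B i j \is 1.-homog)
  (hB : B^T = - B).
Local Notation f := (pfaffian (n := 3) B).

Lemma coef_mx_skew i : (coef_mx B i)^T = - coef_mx B i.
Proof.
by apply/matrixP=> j k; have /matrixP/(_ j k) := hB;
  rewrite !mxE => ->; rewrite mcoeffN.
Qed.

Lemma linear_mxE : B = \sum_i 'X_i *: map_mx (mpolyC 3 (R := K)) (coef_mx B i).
Proof.
apply/matrixP=> j k; rewrite summxE (dhomog1E (hlin j k)).
by apply: eq_bigr => i _; rewrite !mxE mulrC mul_mpolyC.
Qed.

Lemma det_pfaffian : \det B = f ^+ 2.
Proof.
apply: pfaffian_sqr => // i.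
have /matrixP/(_ i i) := hB; rewrite !mxE => e.
have : 2%:R%:MP * B i i = 0 by rewrite mpolyCMn mpolyC1 mulr_natl mulr2n {1}e addNr.
by move/eqP; rewrite mulf_eq0 mpolyC_eq0 (negPf two_neq0) => /eqP.
Qed.

Lemma det_pencil (v : 'rV[K]_3) :
  \det (\sum_i v 0 i *: coef_mx B i) = row_eval f v ^+ 2.
Proof.
rewrite /row_eval -rmorphXn -det_pfaffian -det_map_mx; congr (\det _).
rewrite {2}linear_mxE raddf_sum; apply: eq_bigr => i _ /=.
by apply/matrixP=> j k; rewrite !mxE mevalM mevalXU mevalC.
Qed.

(** A vector in the radical, read over the polynomial ring, is killed by [B]; multiplying by the
    adjugate, it is killed by [\det B], the square of the Pfaffian. *)
Lemma pfaffian_nondegenerate : f != 0 -> nondegenerate B.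
Proof.
move=> f0 u hu; apply/eqP/negPn/negP => u0.
have uC i : u^T *m coef_mx B i = 0.
  apply/rowP=> j; have := hu (delta_mx j 0) => /rowP/(_ i).
  by rewrite tensorE -colE !mxE => ->.
have uB : map_mx (mpolyC 3 (R := K)) u^T *m B = 0.
  rewrite {1}linear_mxE mulmx_sumr big1 // => i _.
  by rewrite -scalemxAr -map_mxM uC map_mx0 scaler0.
have [i ui] : exists i, u i 0 != 0.
  apply/existsP; apply: contraNT u0; rewrite negb_exists => /forallP u0.
  by apply/eqP/colP=> i; rewrite mxE; apply/eqP/negPn.
have : \det B *: map_mx (mpolyC 3 (R := K)) u^T = 0.
  by rewrite -mul_mx_scalar -mul_mx_adj mulmxA uB mul0mx.
move=> /rowP/(_ i)/eqP; rewrite !mxE mulf_eq0 mpolyC_eq0 (negPf ui) orbF.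
by rewrite det_pfaffian expf_eq0 (negPf f0).
Qed.

Lemma det_anti_block (R : comNzRingType) n (J : 'M[R]_n) :
  \det (block_mx 0 J (- J^T) 0) = \det J ^+ 2.
Proof.
(* The three unipotent factors multiply to the block matrix with rows (0, 1) and (-1, 0). *)
have -> : block_mx 0 J (- J^T) 0 = block_mx J 0 0 J^T *m
    (block_mx 1%:M 1%:M 0 1%:M *m block_mx 1%:M 0 (- 1%:M) 1%:M *m
     block_mx 1%:M 1%:M 0 1%:M).
  rewrite !mulmx_block !(mulmx0, mul0mx, mulmx1, mul1mx, addr0, add0r).
  by rewrite addrN addNr add0r !mulmx0 mulmx1 mulmxN mulmx1.
by rewrite !det_mulmx !det_ublock !det_lblock !det1 det_tr !mulr1.
Qed.

(** The images of [al] and [1 - al] are complementary, and isotropic since t(al u, al v) = t(u, (1 -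
    al) al v) = 0. The value of the pencil at [v] is invertible and intertwines [al^T] with
    [1 - al], so both ranks are 3. *)
Lemma idempotent_frame (al : 'M[K]_6) (v : 'rV[K]_3) :
  al *m al = al -> (forall i, al^T *m coef_mx B i = coef_mx B i *m (1%:M - al)) ->
  row_eval f v != 0 ->
  exists (P : 'M[K]_6) (J : 'I_3 -> 'M[K]_3), P \in unitmx /\
    forall i, P^T *m coef_mx B i *m P = block_mx 0 (J i) (- (J i)^T) 0 :> 'M_(3 + 3).
Proof.
move=> al_idem adj_al fv.
have al_be : al *m (1%:M - al) = 0 by rewrite mulmxBr mulmx1 al_idem subrr.
have be_idem : (1%:M - al) *m (1%:M - al) = 1%:M - al.
  by rewrite mulmxBl mul1mx al_be subr0.
have be_al : (1%:M - al) *m al = 0 by rewrite mulmxBl mul1mx al_idem subrr.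
have rank_eq : \rank (1%:M - al) = \rank al.
  pose D := \sum_i v 0 i *: coef_mx B i.
  have Du : D \in unitmx by rewrite unitmxE unitfE det_pencil expf_eq0.
  have aD : al^T *m D = D *m (1%:M - al).
    rewrite mulmx_sumr mulmx_suml; apply: eq_bigr => i _.
    by rewrite -scalemxAr adj_al scalemxAl.
  by rewrite -(mxrank_tr al) -(mxrankMfree al^T (_ : row_free D)) ?aD ?row_free_unit //
    -(mxrank_tr (D *m _)) trmx_mul mxrankMfree ?mxrank_tr // row_free_unit unitmx_tr.
have rank_al : \rank al = 3%N.
  have : (\rank al + \rank (1%:M - al)%R = 6)%N.
    apply/eqP; rewrite eqn_leq mulmx0_rank_max //=.
    have e : al + (1%:M - al) = 1%:M by rewrite addrC subrK.
    by apply: leq_trans (mxrank_add _ _); rewrite e mxrank1.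
  by rewrite rank_eq addnn => /(@double_inj _ 3).
(* The columns of [C] form a basis of the image of the idempotent [A]. *)
have split r (A : 'M[K]_6) : A *m A = A -> \rank A = r ->
    exists (C : 'M[K]_(6, r)) (R : 'M[K]_(r, 6)), A = C *m R /\ A *m C = C.
  move=> AA <-; exists (col_base A), (row_base A); rewrite mulmx_base; split=> //.
  apply: (row_free_inj (row_base_free A)).
  by rewrite -mulmxA mulmx_base AA.
have [C [R [CR alC]]] := split _ _ al_idem rank_al.
have [C' [R' [CR' beC']]] := split _ _ be_idem (etrans rank_eq rank_al).
have beC : (1%:M - al) *m C = 0 by rewrite -alC mulmxA be_al mul0mx.
have adj_be i : (1%:M - al)^T *m coef_mx B i = coef_mx B i *m al.
  by rewrite linearB /= trmx1 mulmxBl mul1mx adj_al mulmxBr mulmx1 subKr.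
have alC' : al *m C' = 0 by rewrite -beC' mulmxA al_be mul0mx.
have PR : row_mx C C' *m col_mx R R' = 1%:M.
  by rewrite mul_row_col -CR -CR' addrC subrK.
exists (row_mx C C' : 'M_(6, 3 + 3)), (fun i => C^T *m coef_mx B i *m C').
split=> [|i]; first exact: proj1 (mulmx1_unit PR).
transitivity ((row_mx C C')^T *m coef_mx B i *m row_mx C C'); first by [].
rewrite tr_row_mx mul_col_mx mul_mx_row !mul_col_mx -[LHS]block_mxEh.
congr block_mx.
- by rewrite -{1}alC trmx_mul -(mulmxA C^T) adj_al -!mulmxA beC !mulmx0.
- by rewrite !trmx_mul trmxK coef_mx_skew mulNmx mulmxN opprK mulmxA.
- by rewrite -{1}beC' trmx_mul -(mulmxA C'^T) adj_be -!mulmxA alC' !mulmx0.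
Qed.

(** Comparing determinants gives [\det Jm ^+ 2 = (\det P * f) ^+ 2]; polynomials form a domain, so
    the two bases agree up to sign. *)
Lemma isotropic_pencil (P : 'M[K]_6) (J : 'I_3 -> 'M[K]_3) : P \in unitmx ->
  (forall i, P^T *m coef_mx B i *m P = block_mx 0 (J i) (- (J i)^T) 0 :> 'M_(3 + 3)) ->
  exists2 d, d != 0 & forall v : 'rV[K]_3, \det (\sum_i v 0 i *: J i) = d * row_eval f v.
Proof.
move=> Punit hP; pose lift m n := @map_mx K {mpoly K[3]} (mpolyC 3 (R := K)) m n.
pose Jm : 'M[{mpoly K[3]}]_3 := \sum_i 'X_i *: lift _ _ (J i).
have PBP : (lift _ _ P)^T *m B *m lift _ _ P = block_mx 0 Jm (- Jm^T) 0 :> 'M_(3 + 3).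
  rewrite linear_mxE mulmx_sumr mulmx_suml.
  transitivity (\sum_i 'X_i *: lift _ _ (P^T *m coef_mx B i *m P)).
    by apply: eq_bigr => i _; rewrite -scalemxAr -scalemxAl /lift !map_mxM map_trmx.
  apply/matrixP=> j k; rewrite summxE.
  under eq_bigr do rewrite hP 2!mxE.
  case: (split_ordP j) => j' ->; case: (split_ordP k) => k' ->.
  - rewrite block_mxEul mxE big1 // => i _.
    by rewrite (@block_mxEul K 3 3 3 3) mxE mpolyC0 mulr0.
  - rewrite block_mxEur summxE; apply: eq_bigr => i _.
    by rewrite (@block_mxEur K 3 3 3 3) !mxE.
  - rewrite block_mxEdl !mxE summxE -sumrN; apply: eq_bigr => i _.
    by rewrite (@block_mxEdl K 3 3 3 3) !mxE mpolyCN mulrN.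
  - rewrite block_mxEdr mxE big1 // => i _.
    by rewrite (@block_mxEdr K 3 3 3 3) mxE mpolyC0 mulr0.
have := congr1 determinant PBP; rewrite !det_mulmx det_tr det_pfaffian.
rewrite [in RHS]det_anti_block => e.
pose d := \det P; have d0 : d != 0 by rewrite -unitfE -unitmxE.
have dP : \det (lift _ _ P) = d%:MP by rewrite det_map_mx.
have {}e : \det Jm ^+ 2 = (d%:MP * f) ^+ 2 by rewrite -e dP; ring.
have [d' d'0 JE] : exists2 d', d' != 0 & \det Jm = d' *: f.
  move/eqP: e; rewrite eqf_sqr => /orP[] /eqP ->.
    by exists d; rewrite // mul_mpolyC.
  by exists (- d); rewrite ?oppr_eq0 // mul_mpolyC scaleNr.
exists d' => // v; rewrite /row_eval -mevalZ -JE -det_map_mx; congr (\det _).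
rewrite /Jm raddf_sum; apply: eq_bigr => i _ /=.
by apply/matrixP=> j k; rewrite !mxE mevalM mevalXU mevalC.
Qed.

Lemma pencil_B_EP_iso (N : 'M[K]_3) (P : 'M[K]_6) (J : 'I_3 -> 'M[K]_3)
    (U V : 'M[K]_3) a lam mu :
  N \in unitmx -> P \in unitmx -> U \in unitmx -> V \in unitmx ->
  (forall i, P^T *m coef_mx B i *m P = block_mx 0 (J i) (- (J i)^T) 0 :> 'M_(3 + 3)) ->
  (forall i, U *m (\sum_j N i j *: J j) *m V = J_coef a lam mu i) ->
  group_iso (baer B) (baer (B_EP a lam mu)).
Proof.
move=> Nu Pu Uu Vu hP hUV.
(* Congruence by [D] turns the upper right block S into [U *m S *m V]; the coordinate change [N]
   acts on the centre. *)
pose D : 'M[K]_6 := block_mx U^T 0 0 V : 'M_(3 + 3).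
have Du : D \in unitmx.
  by rewrite unitmxE (@det_ublock _ 3 3) unitrM -!unitmxE unitmx_tr Uu Vu.
pose T := P *m D; have Tu : T \in unitmx by rewrite unitmx_mul Pu.
have TE i : T^T *m (\sum_j N i j *: coef_mx B j) *m T = coef_mx (B_EP a lam mu) i.
  transitivity (D^T *m (\sum_j N i j *: (P^T *m coef_mx B j *m P)) *m D).
    rewrite /T trmx_mul -!mulmxA; congr (_ *m _); rewrite !mulmxA; congr (_ *m _).
    rewrite mulmx_sumr mulmx_suml; apply: eq_bigr => j _.
    by rewrite -scalemxAr -scalemxAl.
  rewrite coef_B_EP -hUV; set S := \sum_j N i j *: J j.
  pose blk (X : 'M[K]_3) : 'M[K]_6 := block_mx 0 X (- X^T) 0 : 'M_(3 + 3).
  have blkD : {morph blk : X Y / X + Y}.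
    move=> X Y; rewrite /blk linearD opprD.
    apply: etrans _ (esym (@add_block_mx _ 3 3 3 3 _ _ _ _ _ _ _ _)).
    by rewrite !addr0.
  have blk0 : blk 0 = 0 by rewrite /blk trmx0 oppr0 (@block_mx0 _ 3 3 3 3).
  have -> : \sum_j N i j *: (P^T *m coef_mx B j *m P) = blk S.
    rewrite /S (big_morph blk blkD blk0); apply: eq_bigr => j _.
    rewrite hP /blk (@scale_block_mx _ 3 3 3 3).
    by rewrite !scaler0 scalerN -linearZ.
  rewrite /blk; transitivity ((block_mx U^T 0 0 V)^T *m
    block_mx 0 S (- S^T) 0 *m block_mx U^T 0 0 V); first by [].
  rewrite tr_block_mx !mulmx_block trmxK !trmx0 !(mulmx0, mul0mx, addr0, add0r).
  by rewrite mulmxN mulNmx !trmx_mul !mulmxA.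
clearbody T; apply: (@pseudo_isometry_group_iso _ _ _ (invmx T) N^T);
  rewrite ?unitmx_inv ?unitmx_tr //.
move=> u v; apply/rowP=> i; rewrite tensorE -TE [RHS]mxE.
rewrite trmx_mul trmx_inv !mulmxA mulmxKV ?unitmx_tr // mulmxK //.
rewrite mulmx_sumr mulmx_suml summxE; apply: eq_bigr => j _.
by rewrite -scalemxAr -scalemxAl !mxE mulrC.
Qed.

End Pencil.

(** * The two equivalences *)

Section Main.
Variable K : fieldType.

Lemma star_iso_idempotent (A1 A2 : algType K) (s1 : A1 -> A1) (s2 : A2 -> A2) (p : A2) :
  star_iso s1 s2 -> p * p = p -> s2 p = 1 - p ->
  exists e, e * e = e /\ s1 e = 1 - e.
Proof.
case=> phi [psi psiK phiK] phi_star pp sp; exists (psi p).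
have phi_inj := can_inj psiK.
split; apply: phi_inj.
  by rewrite [LHS]rmorphM /= phiK.
by rewrite phi_star [RHS]rmorphB rmorph1 /= phiK sp.
Qed.

(** [X1] is commutative, whereas two matrix units of [S2] do not commute. *)
Lemma star_iso_X1_S2 (A : algType K) (s : A -> A) :
  star_iso s (@X1_star K) -> star_iso s (@S2_star K) -> False.
Proof.
case=> phi [phi' phiK _] _ [psi [psi' _ psiK] _].
have comm (x y : A) : x * y = y * x.
  by apply: (can_inj phiK); rewrite !rmorphM; congr pair; apply: mulrC.
have := congr1 psi (comm (psi' (delta_mx 0 0)) (psi' (delta_mx 0 1))).
rewrite [LHS]rmorphM [RHS]rmorphM /= !psiK => /matrixP/(_ 0 1).
rewrite [LHS]mxE [RHS]mxE !sum_ord2_01 !mxE /= !(mulr0, mul0r, mulr1, addr0) => /eqP.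
by rewrite oner_eq0.
Qed.

Variables (B : 'M[{mpoly K[3]}]_6) (hB : B^T = - B).
Hypotheses (two_neq0 : 2 != 0 :> K) (hlin : forall i j : 'I_6, B i j \is 1.-homog).
Local Notation f := (pfaffian (n := 3) B).

Lemma idempotent_group_iso (O : 'rV[K]_3) (M : 'M[K]_3) (a b : K) (e : adj B) :
  weierstrass_coords f O M a b -> e * e = e -> adj_star hB e = 1 - e ->
  exists (P : 'rV[K]_3) (lam mu : K), [/\ on_curve f P,
    proj_eq (P *m M) (point lam mu 1) & group_iso (baer B) (baer (B_EP a lam mu))].
Proof.
move=> hW ee se; have [c c0 fE] := weierstrass_eval hW; case: hW => Mu _ _.
pose al : 'M[K]_6 := (val e).1.
have al_idem : al *m al = al by have /(congr1 (fun x : adj B => (val x).1)) := ee.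
have be : (val e).2 = 1%:M - al :> 'M[K]_6.
  by have /(congr1 (fun x : adj B => (val x).1)) := se.
have adj_al i : al^T *m coef_mx B i = coef_mx B i *m (1%:M - al).
  by have /forallP/(_ i)/eqP := valP e; rewrite be.
(* In Weierstrass coordinates (1 : 0 : 0) is off the cubic, which takes the value [- c] there. *)
have v0 : row_eval f (point 1 0 0 *m invmx M) != 0.
  rewrite fE mulmxKV // !pointE mulf_neq0 //.
  rewrite (_ : _ - _ = -1) ?oppr_eq0 ?oner_eq0 //; ring.
have [P [J [Pu hP]]] := idempotent_frame two_neq0 hlin hB al_idem adj_al v0.
have [d d0 detJ] := isotropic_pencil two_neq0 hlin hB Pu hP.
pose N := invmx M; pose J' i := \sum_j N i j *: J j.
have : weierstrass_pencil (d * c) a b (J' i0) (J' i1) (J' i2).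
  move=> x y z; transitivity (\det (\sum_j (point x y z *m N) 0 j *: J j)).
    congr (\det _); rewrite !scaler_sumr -!big_split; apply: eq_bigr => j _ /=.
    by rewrite !scalerA -!scalerDl mxE sum_ord3 !mxE.
  by rewrite detJ fE /N mulmxKV // !pointE; ring.
case/(pencil_normalizable two_neq0 (mulf_neq0 d0 c0)).
move=> U [V [lam [mu [Uu Vu muE [h0 h1 h2]]]]].
(* The point with Weierstrass coordinates (lam : mu : 1), carried back to the original ones. *)
exists (point lam mu 1 *m N), lam, mu; split.
- rewrite /on_curve -/(row_eval f _) fE /N mulmxKV // !pointE; apply/andP; split.
    apply/eqP => /(congr1 (mulmx^~ M)); rewrite mulmxKV // mul0mx => /rowP/(_ i2)/eqP.
    by rewrite !mxE oner_eq0.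
  by rewrite muE; apply/eqP; ring.
- by exists 1; rewrite ?oner_eq0 // scale1r /N mulmxKV.
- apply: (pencil_B_EP_iso (N := N) _ Pu Uu Vu hP); first by rewrite unitmx_inv.
  exact: ord3P.
Qed.

(** The forward direction of both equivalences. As the two cases are exhaustive and their algebras
    not isomorphic, it also decides in the backward direction whether the point found is
    2-torsion. *)
Lemma group_iso_star_iso (a lam mu : K) : f != 0 ->
  group_iso (baer B) (baer (B_EP a lam mu)) ->
  (mu = 0 -> star_iso (adj_star hB) (@S2_star K)) /\
  (mu <> 0 -> star_iso (adj_star hB) (@X1_star K)).
Proof.
move=> f0 hiso; have ndB := pfaffian_nondegenerate two_neq0 hlin hB f0.
have [Q [a' [lam' [mu' [Qu mu0 hQ]]]]] := group_iso_B_EP two_neq0 hB ndB hiso.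
split=> hmu; first by apply: (star_iso_S2 hB two_neq0 Qu hQ); apply/mu0.
by apply: (star_iso_X1 hB two_neq0 Qu hQ); apply/eqP => /mu0.
Qed.

End Main.

(** The model groups refer to Weierstrass coordinates: such coordinates are shown to exist, and the
    equivalences are proved for every choice of them. *)
Theorem theorem4 (K : fieldType) (hK : 6%:R != 0 :> K)
    (B : 'M[{mpoly K[3]}]_6)
    (hlin : forall i j : 'I_6, B i j \is 1.-homog)
    (hskew : B^T = - B)
    (hsmooth : smooth_cubic (pfaffian (n := 3) B))
    (O : 'rV[K]_3) (hO : is_flex (pfaffian (n := 3) B) O) :
  let E := pfaffian (n := 3) B in
  (exists (M : 'M[K]_3) (a b : K), weierstrass_coords E O M a b) /\
  (forall (M : 'M[K]_3) (a b : K), weierstrass_coords E O M a b ->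
    ((exists (P : 'rV[K]_3) (lam mu : K),
        [/\ on_curve E P, ~ two_torsion E O P,
            proj_eq (P *m M) (point lam mu 1)
          & group_iso (baer B) (baer (B_EP a lam mu))])
     <-> star_iso (adj_star hskew) (@X1_star K)) /\
    ((exists (P : 'rV[K]_3) (lam mu : K),
        [/\ on_curve E P, two_torsion E O P, ~ proj_eq P O,
            proj_eq (P *m M) (point lam mu 1)
          & group_iso (baer B) (baer (B_EP a lam mu))])
     <-> star_iso (adj_star hskew) (@S2_star K))).
Proof.
have two_neq0 : 2 != 0 :> K.
  by apply: contraNneq hK => h; rewrite (natrM K 2 3) h mul0r.
move=> E; split; first exact: weierstrass_exists.
have [f0 hf _] := hsmooth.
move=> M a b hW.
have torsion P lam mu := two_torsion_mu (lam := lam) (mu := mu) (P := P) two_neq0 hf hO hW.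
have to_star a' lam mu := @group_iso_star_iso _ _ hskew two_neq0 hlin a' lam mu f0.
have from_idem := idempotent_group_iso two_neq0 hlin hW.
split; split.
- case=> P [lam [mu [PE nP PM /to_star[_]]]]; apply=> mu0; apply: nP.
  exact/(torsion _ _ _ PE PM).
(* The idempotent (1, 0) is sent by the involution to (0, 1), its complement. *)
- move=> hX; have [||e [ee se]] := star_iso_idempotent (p := (1, 0) : X1 K) hX.
  + by congr pair; rewrite /= ?mulr1 ?mulr0.
  + by congr pair; rewrite /= ?subr0 ?subrr.
  have [P [lam [mu [PE PM hiso]]]] := from_idem hskew e ee se.
  exists P, lam, mu; split=> // /(torsion _ _ _ PE PM) mu0.
  have [/(_ mu0) hS _] := to_star _ _ _ hiso.
  exact: star_iso_X1_S2 hX hS.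
- case=> P [lam [mu [PE tP _ PM /to_star[+ _]]]]; apply.
  exact/(torsion _ _ _ PE PM).
(* The involution of [S2] exchanges the two diagonal matrix units, so it sends the first to its
   complement. *)
- move=> hS; have [||e [ee se]] := star_iso_idempotent (p := delta_mx 0 0 : S2 K) hS.
  + by rewrite -[_ * _]/(_ *m _) mul_delta_mx.
  + have [s00 s01 s10 s11] := S2_starE (delta_mx 0 0 : 'M[K]_2).
    by apply: mx2P; rewrite ?s00 ?s01 ?s10 ?s11 !mxE /= ?subr0 ?subrr ?oppr0.
  have [P [lam [mu [PE PM hiso]]]] := from_idem hskew e ee se.
  have mu0 : mu = 0.
    apply/eqP/negPn/negP => /eqP mu0; have [_ /(_ mu0) hX] := to_star _ _ _ hiso.
    exact: star_iso_X1_S2 hX hS.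
  exists P, lam, mu; split=> //; first exact/(torsion _ _ _ PE PM).
  (* [P] differs from [O]: its third Weierstrass coordinate is nonzero, that of [O] is 0. *)
  case=> k k0 PO; case: hW => _ _ [k' _ OM]; case: PM => k'' k''0.
  rewrite PO -scalemxAl OM => /rowP/(_ i2)/eqP; rewrite !mxE /= !mulr0 mulr1 eq_sym.
  by rewrite (negPf k''0).
Qed.
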